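(* For $n\ge1$ let $W(C_{2n})=G(2,1,2n)$ and $W(D_{2n})=G(2,2,2n)$ be the Weyl groups of types $C_{2n}$ and $D_{2n}$ acting on $\mathbf{C}^{2n}$, and let $L_{1/2n}(C_{2n})$, $L_{1/2n}(D_{2n})$ denote the irreducible modules $L_c(\mathrm{Triv})$ for the corresponding rational Cherednik algebras with constant parameter $c=1/2n$. Then, as formal power series in $x$, $$\sum_{n>0}\dim_{\mathbf{C}}\big(L_{1/2n}(D_{2n})\big)x^{n-1}=(1-4x)^{-3/2}$$ and $$1+\sum_{n>0}\dim_{\mathbf{C}}\big(L_{1/2n}(C_{2n})\big)x^{n}=(1-4x)^{-3/2}\,\frac{(1+\sqrt{1-4x})^2}{4}.$$
   Context: $G(2,1,2n)$ is the group of all $2n\times 2n$ signed permutation matrices and $G(2,2,2n)$ the subgroup of those with an even number of entries $-1$. For a finite group $W\subset GL(V)$ generated by reflections and a constant $c\in\mathbf{C}$, the rational Cherednik algebra $H_c(W)$ is the subalgebra of $\mathrm{End}_{\mathbf{C}}(\mathbf{C}[V])$ generated by $W$, $\mathbf{C}[V]$ and the Dunkl operators $y(f)=\partial_yf-\sum_{s}c\,\langle\alpha_s,y\rangle\frac{f-s(f)}{\alpha_s}$ for $y\in V$, where $s$ runs over the reflections in $W$ and $\alpha_s\in V^*$ is a linear form defining the fixed hyperplane of $s$. $L_c(\mathrm{Triv})$ is the unique irreducible quotient of the polynomial representation $\Delta_c(\mathrm{Triv})=\mathbf{C}[V]$ in category $\mathcal{O}_c$. *)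

(* Defs.v *)
From HB Require Import structures.
From mathcomp Require Import all_boot all_order all_algebra perm finmap.
From mathcomp Require Import complex mpoly generic_quotient ring_quotient.
From mathcomp Require Import boolp reals.

Set Implicit Arguments.
Unset Strict Implicit.
Unset Printing Implicit Defensive.

Import Order.TTheory GRing.Theory Num.Theory.

Local Open Scope ring_scope.

Record mxgroup (F : fieldType) (N : nat) := MxGroup {
  mxg_set :> {fset 'M[F]_N};
  mxg1 : 1%:M \in mxg_set;
  mxgM : {in mxg_set &, forall u v, u *m v \in mxg_set};
  mxg_unit : {in mxg_set, forall u, u \in unitmx};
  mxgV : {in mxg_set, forall u, invmx u \in mxg_set}
}.

Section Cherednik.

Variables (F : numFieldType) (N : nat).
Local Notation P := {mpoly F[N]}.
Local Notation M0 := (0%MM : 'X_{1..N}).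

(* V is 'cV[F]_N, V^* is 'rV[F]_N, and F[V] is {mpoly F[N]}. *)
Definition lform (a : 'rV[F]_N) : P := \sum_i a 0 i *: 'X_i.

(* (w f)(v) = f(w^-1 v) *)
Definition gact (w : 'M[F]_N) (f : P) : P :=
  f \mPo [tuple lform (row i (invmx w)) | i < N].

Definition is_reflection (s : 'M[F]_N) : bool := \rank (s - 1%:M) == 1%N.

(* All rows of s - 1 are multiples of this one, so its kernel is the fixed
   hyperplane of s. *)
Definition alpha (s : 'M[F]_N) : 'rV[F]_N := nz_row (s - 1%:M).

(* Exact division: the q with q * a = g; see divided_difference_exists. *)
Definition mdivide (g a : P) : P :=
  if pselect (exists q, q * a = g) is left e then projT1 (cid e) else 0.

Definition dderiv (y : 'cV[F]_N) (f : P) : P := \sum_i y i 0 *: f^`M(i).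

Definition dunkl (W : mxgroup F N) (c : F) (y : 'cV[F]_N) (f : P) : P :=
  dderiv y f - \sum_(s <- W | is_reflection s)
    (c * (alpha s *m y) 0 0) *: mdivide (f - gact s f) (lform (alpha s)).

(* The subalgebra H_c(W) of End_F(F[V]), as a set of operators. *)
Inductive cherednik (W : mxgroup F N) (c : F) : (P -> P) -> Prop :=
| cherednik_group w : w \in mxg_set W -> cherednik W c (gact w)
| cherednik_poly p : cherednik W c (fun f => p * f)
| cherednik_dunkl y : cherednik W c (dunkl W c y)
| cherednik_id : cherednik W c id
| cherednik_comp h k :
    cherednik W c h -> cherednik W c k -> cherednik W c (h \o k)
| cherednik_add h k :
    cherednik W c h -> cherednik W c k -> cherednik W c (fun f => h f + k f)
| cherednik_scale a h : cherednik W c h -> cherednik W c (fun f => a *: h f).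

Definition submodule (W : mxgroup F N) (c : F) (M : {pred P}) : Prop :=
  [/\ 0 \in M,
      {in M &, forall f g, f + g \in M}
    & forall h, cherednik W c h -> {in M, forall f, h f \in M}].

(* F[V]/J is an irreducible H_c(W)-module: its submodules are the M/J, for M a
   submodule of F[V] containing J. Every quotient of F[V] = Delta_c(Triv) is in
   category O_c, so irreducibility there is irreducibility over H_c(W). *)
Definition irreducible_quotient W c (J : {pred P}) : Prop :=
  [/\ submodule W c J,
      exists f, f \notin J
    & forall M : {pred P}, submodule W c M -> {subset J <= M} ->
        M =i J \/ M =i predT].

Lemma lform_is_linear : linear lform.
Proof.
move=> a u v; rewrite /lform scaler_sumr -big_split; apply: eq_bigr => i _.
by rewrite /= !mxE scalerDl scalerA.
Qed.
HB.instance Definition _ := GRing.isLinear.Build F 'rV[F]_N P _ lform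
  lform_is_linear.

Lemma coef_lform a i : (lform a)@_U_(i)%MM = a 0 i.
Proof.
rewrite /lform raddf_sum (bigD1 i) //= mcoeffZ mcoeffXU eqxx mulr1.
rewrite big1 ?addr0 // => j ji.
by rewrite mcoeffZ mcoeffXU (negPf ji) mulr0.
Qed.

Lemma lform_eq0 a : (lform a == 0) = (a == 0).
Proof.
apply/eqP/eqP => [e|->]; last by rewrite raddf0.
by apply/rowP => i; rewrite -coef_lform e mcoeff0 mxE.
Qed.

Lemma gact_is_linear w : linear (gact w).
Proof. by move=> a p q; rewrite /gact linearP. Qed.
HB.instance Definition _ w := GRing.isLinear.Build F P P _ (gact w)
  (gact_is_linear w).

Lemma gactM w p q : gact w (p * q) = gact w p * gact w q.
Proof. by rewrite /gact rmorphM. Qed.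

Lemma gact1 w : gact w 1 = 1.
Proof. by rewrite /gact rmorph1. Qed.

Lemma gactX w i : gact w 'X_i = lform (row i (invmx w)).
Proof. by rewrite /gact comp_mpolyXU -tnth_nth tnth_mktuple. Qed.

Lemma mpoly_alg_ind (Q : P -> Prop) :
  Q 1 -> (forall i, Q 'X_i) -> (forall p q, Q p -> Q q -> Q (p * q)) ->
  (forall p q, Q p -> Q q -> Q (p + q)) -> (forall a p, Q p -> Q (a *: p)) ->
  forall p, Q p.
Proof.
move=> Q1 QX QM QD QZ; elim/mpolyind => [|a m p _ _ Qp].
  by rewrite -(scale0r 1); apply: QZ.
apply: QD => //; apply: QZ; rewrite mpolyXE_id; apply: big_ind => // i _.
by elim: (m i) => [|k IH]; rewrite ?expr0 // exprS; apply: QM.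
Qed.

Lemma alpha_neq0 s : is_reflection s -> alpha s != 0.
Proof. by rewrite /is_reflection /alpha nz_row_eq0 -mxrank_eq0 => /eqP ->. Qed.

Lemma alpha_span s (v : 'rV_N) : is_reflection s ->
  (v <= s - 1%:M)%MS -> exists a, v = a *: alpha s.
Proof.
move=> rs vs; have a0 := alpha_neq0 rs.
have sub : (alpha s <= s - 1%:M)%MS by exact: nz_row_sub.
have : (s - 1%:M <= alpha s)%MS.
  by rewrite -(geq_leqif (mxrank_leqif_sup sub)) (eqP rs) rank_rV a0.
by move/(submx_trans vs)/sub_rVP.
Qed.

Lemma divided_difference_exists s f : is_reflection s ->
  exists q, q * lform (alpha s) = f - gact s f.
Proof.
move=> rs; elim/mpoly_alg_ind: f.
- by exists 0; rewrite gact1 subrr mul0r.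
- move=> i; rewrite gactX.
  have -> : 'X_i - lform (row i (invmx s)) = lform (row i (1%:M - invmx s)).
    rewrite [row i (_ - _)]raddfB [RHS]raddfB /= row1; congr (_ - _).
    rewrite /lform (bigD1 i) //= mxE !eqxx scale1r big1 ?addr0 // => j ji.
    by rewrite mxE eqxx (negPf ji) scale0r.
  have [|a ->] := @alpha_span s (row i (1%:M - invmx s)) rs.
    apply: (submx_trans (row_sub _ _)).
    have [us|nus] := boolP (s \in unitmx); last first.
      rewrite /invmx (negPf nus) -(opprB s).
      by rewrite -[X in - X]mul1mx -mulNmx submxMl.
    have -> : 1%:M - invmx s = invmx s *m (s - 1%:M).
      by rewrite mulmxBr mulVmx // mulmx1.
    exact: submxMl.
  by exists a%:MP; rewrite linearZ /= mul_mpolyC.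
- move=> p q [u eu] [v ev]; exists (p * v + u * gact s q).
  rewrite gactM mulrDl -mulrA ev mulrAC eu mulrBl mulrBr.
  by rewrite [_ - p * gact s q + _]addrA subrK.
- move=> p q [u eu] [v ev]; exists (u + v).
  by rewrite mulrDl eu ev raddfD opprD addrACA.
- move=> a p [u eu]; exists (a *: u).
  by rewrite -scalerAl eu linearZ scalerBr.
Qed.

Lemma mdivideK (g a : P) : (exists q, q * a = g) -> mdivide g a * a = g.
Proof. by rewrite /mdivide; case: pselect => // e _; case: (cid e). Qed.

Lemma mdivide_eq (g a q : P) : a != 0 -> q * a = g -> mdivide g a = q.
Proof.
by move=> a0 e; apply: (mulIf a0); rewrite e; apply: mdivideK; exists q.
Qed.

Lemma dunkl_is_linear W c y : linear (dunkl W c y).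
Proof.
move=> a p q; rewrite /dunkl /dderiv scalerBr addrACA -opprD; congr (_ - _).
  rewrite scaler_sumr -big_split; apply: eq_bigr => i _ /=.
  by rewrite mderivD mderivZ scalerDr !scalerA mulrC.
rewrite scaler_sumr -big_split; apply: eq_bigr => s rs /=.
set l := lform _; have l0 : l != 0 by rewrite lform_eq0 alpha_neq0.
have -> : mdivide (a *: p + q - gact s (a *: p + q)) l =
    a *: mdivide (p - gact s p) l + mdivide (q - gact s q) l.
  apply: mdivide_eq => //; rewrite mulrDl -scalerAl !mdivideK; first last.
  - exact: divided_difference_exists.
  - exact: divided_difference_exists.
  by rewrite linearP scalerBr opprD addrACA.
by rewrite scalerDr !scalerA mulrC.
Qed.

Lemma cherednik_linear W c h : cherednik W c h -> linear h.
Proof.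
elim=> {h} [w _|p|y||h k _ Lh _ Lk|h k _ Lh _ Lk|b h _ Lh] a u v /=.
- exact: linearP.
- by rewrite mulrDr scalerAr.
- exact: dunkl_is_linear.
- by [].
- by rewrite Lk Lh.
- by rewrite Lh Lk scalerDr addrACA.
- by rewrite Lh scalerDr !scalerA mulrC.
Qed.

Lemma submoduleZ W c M a f : submodule W c M -> f \in M -> a *: f \in M.
Proof.
by case=> _ _ H; apply: (H (fun g => a *: g)); apply/cherednik_scale/cherednik_id.
Qed.

Lemma submodule_predT W c M : submodule W c M -> 1 \in M -> M =i predT.
Proof.
case=> _ _ H M1 f; rewrite inE -(mulr1 f).
by apply: (H (fun g => f * g)) => //; apply: cherednik_poly.
Qed.

Definition euler (f : P) : P := \sum_i 'X_i * f^`M(i).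

Lemma euler_is_linear : linear euler.
Proof.
move=> a p q; rewrite /euler scaler_sumr -big_split; apply: eq_bigr => i _ /=.
by rewrite mderivD mderivZ mulrDr scalerAr.
Qed.
HB.instance Definition _ := GRing.isLinear.Build F P P _ euler euler_is_linear.

Lemma eulerM p q : euler (p * q) = euler p * q + p * euler q.
Proof.
rewrite /euler mulr_suml mulr_sumr -big_split; apply: eq_bigr => i _ /=.
by rewrite mderivM mulrDr !mulrA [p * _]mulrC.
Qed.

Lemma eulerX m : euler 'X_[m] = (mdeg m)%:R *: 'X_[m].
Proof.
rewrite /euler mdegE natr_sum scaler_suml; apply: eq_bigr => i _.
rewrite mderivX -scalerAr -mpolyXD; have [->|mi] := eqVneq (m i) 0%N.
  by rewrite !scale0r.
by rewrite addmC submK // lep1mP.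
Qed.

Lemma euler1 : euler 1 = 0.
Proof. by rewrite -mpolyX0 eulerX mdeg0 scale0r. Qed.

Lemma euler_lform a : euler (lform a) = lform a.
Proof.
rewrite /lform raddf_sum; apply: eq_bigr => i _ /=.
by rewrite linearZ /= eulerX mdeg1 scale1r.
Qed.

Lemma coef_euler f m : (euler f)@_m = (mdeg m)%:R * f@_m.
Proof.
elim/mpolyind: f => [|a k p _ _ IH]; first by rewrite raddf0 !mcoeff0 mulr0.
rewrite raddfD /= linearZ /= eulerX !mcoeffD !mcoeffZ IH mulrDr mcoeffX.
by case: eqP => [->|_]; rewrite ?mulr1 ?mulr0 ?[a * _]mulrC.
Qed.

Lemma gact_euler w f : gact w (euler f) = euler (gact w f).
Proof.
elim/mpoly_alg_ind: f => [|i|p q ep eq|p q ep eq|a p ep].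
- by rewrite gact1 euler1 raddf0.
- by rewrite gactX euler_lform eulerX mdeg1 scale1r gactX.
- by rewrite eulerM raddfD /= !gactM eulerM ep eq.
- by rewrite !raddfD /= ep eq.
- by rewrite !linearZ /= ep.
Qed.

Lemma coef0_gact w f : (gact w f)@_M0 = f@_M0.
Proof.
elim/mpoly_alg_ind: f => [|i|p q ep eq|p q ep eq|a p ep].
- by rewrite gact1.
- rewrite gactX mcoeffX mnm1_eq0 /lform raddf_sum big1 // => j _ /=.
  by rewrite mcoeffZ mcoeffX mnm1_eq0 mulr0.
- by rewrite gactM !(rmorphM (mcoeff 0%MM)) /= ep eq.
- by rewrite raddfD !mcoeffD ep eq.
- by rewrite linearZ !mcoeffZ ep.
Qed.

Lemma gact_mulmx u v f : u \in unitmx -> v \in unitmx ->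
  gact (u *m v) f = gact u (gact v f).
Proof.
move=> uu uv; have iuv : invmx (u *m v) = invmx v *m invmx u.
  have uuv : u *m v \in unitmx by rewrite unitmx_mul uu.
  apply: (can_inj (mulKmx uuv)).
  rewrite mulmxV ?unitmx_mul ?uu // mulmxA -(mulmxA u) mulmxV // mulmx1.
  by rewrite mulmxV.
elim/mpoly_alg_ind: f => [|i|p q ep eq|p q ep eq|a p ep].
- by rewrite !gact1.
- rewrite !gactX iuv row_mul mulmx_sum_row !raddf_sum; apply: eq_bigr => j _ /=.
  by rewrite !linearZ /= gactX.
- by rewrite !gactM ep eq.
- by rewrite !raddfD /= ep eq.
- by rewrite !linearZ /= ep.
Qed.

Section Irreducible.
Variables (W : mxgroup F N) (c : F).

Definition invariant f := forall w, w \in mxg_set W -> gact w f = f.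

Lemma dunkl_invariant y f : invariant f -> dunkl W c y f = dderiv y f.
Proof.
move=> fW; rewrite /dunkl big_seq_cond big1 ?subr0 // => s /andP[sW rs].
rewrite fW // subrr (@mdivide_eq _ _ 0) ?scaler0 ?mul0r //.
by rewrite lform_eq0 alpha_neq0.
Qed.

Lemma dderiv_delta i f : dderiv (delta_mx i 0) f = f^`M(i).
Proof.
rewrite /dderiv (bigD1 i) //= mxE !eqxx scale1r big1 ?addr0 // => j ji.
by rewrite mxE (negPf ji) scale0r.
Qed.

Lemma submodule_sum M (I : Type) (r : seq I) (Q : pred I) (G : I -> P) :
  submodule W c M -> (forall i, Q i -> G i \in M) ->
  \sum_(i <- r | Q i) G i \in M.
Proof. by case=> Mz MD _ GM; apply: (big_ind (fun x => x \in M)). Qed.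

Lemma submodule_euler M f :
  submodule W c M -> invariant f -> f \in M -> euler f \in M.
Proof.
move=> sM fW fM; apply: submodule_sum => // i _.
have [_ _ H] := sM; apply: (H (fun g => 'X_i * g)); first exact: cherednik_poly.
rewrite -dderiv_delta -dunkl_invariant //; apply: H => //.
exact: cherednik_dunkl.
Qed.

Lemma submodule_avg M f : submodule W c M -> f \in M -> f@_M0 != 0 ->
  exists g, [/\ invariant g, g \in M & g@_M0 != 0].
Proof.
move=> sM fM f0; exists (\sum_(w <- W) gact w f); split.
- move=> u uW; rewrite raddf_sum /=.
  have uu := mxg_unit uW.
  transitivity (\sum_(w <- [seq u *m w | w <- mxg_set W]) gact w f).
    rewrite big_map big_seq [RHS]big_seq; apply: eq_bigr => w wW.
    by rewrite gact_mulmx // (mxg_unit wW).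
  apply: perm_big; apply: uniq_perm.
  - by rewrite map_inj_uniq ?fset_uniq //; apply: can_inj (mulKmx uu).
  - exact: fset_uniq.
  move=> v; apply/mapP/idP => [[w wW ->]|vW]; first exact: mxgM.
  exists (invmx u *m v); first by apply: mxgM => //; apply: mxgV.
  by rewrite mulKVmx.
- rewrite big_seq; apply: submodule_sum => // w wW.
  by have [_ _ H] := sM; apply: H => //; apply: cherednik_group.
rewrite raddf_sum /= (eq_bigr (fun=> f@_M0)) => [|w _]; last exact: coef0_gact.
rewrite big_const_seq count_predT iter_addr_0 mulrn_eq0 negb_or f0 andbT.
by apply/eqP => /size0nil W0; move: (mxg1 W : 1%:M \in enum_fset W); rewrite W0.
Qed.

Lemma submodule_coef0 M f : submodule W c M -> f \in M -> f@_M0 != 0 -> 1 \in M.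
Proof.
move=> sM /(submodule_avg sM) H /H {H f} [f [fW fM f0]].
have [d] : exists d, (msize f <= d.+1)%N by exists (msize f).
elim: d f fW fM f0 => [|d IH] f fW fM f0 fd.
  have fE : f = (f@_M0)%:MP by exact: msize1_polyC.
  have -> : 1 = (f@_M0)^-1 *: f :> P.
    by rewrite {2}fE -mul_mpolyC -mpolyCM mulVf.
  exact: (submoduleZ _ sM).
apply: (IH (euler f - d.+1%:R *: f)).
- by move=> w wW; rewrite raddfB /= [gact w (_ *: _)]linearZ /= gact_euler fW.
- have [_ MD _] := sM; rewrite -scaleNr; apply: MD; last exact: (submoduleZ _ sM).
  exact: submodule_euler.
- rewrite mcoeffB coef_euler mdeg0 mul0r sub0r mcoeffZ oppr_eq0 mulf_neq0 //.
  by rewrite pnatr_eq0.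
rewrite msizeE; apply/bigmax_leqP_seq => m; rewrite mcoeff_msupp => mf _.
rewrite ltn_neqAle; move: mf; rewrite mcoeffB coef_euler mcoeffZ -mulrBl.
rewrite mulf_eq0 negb_or subr_eq0 eqr_nat => /andP[-> mf] /=.
rewrite -ltnS; apply: leq_trans fd; apply: msize_mdeg_lt.
by rewrite mcoeff_msupp.
Qed.

Definition J0 : {pred P} :=
  fun f => `[< forall h, cherednik W c h -> (h f)@_M0 = 0 >].

Lemma J0P f : reflect (forall h, cherednik W c h -> (h f)@_M0 = 0) (f \in J0).
Proof. exact: asboolP. Qed.

Lemma J0_submodule : submodule W c J0.
Proof.
split=> [|f g /J0P f0 /J0P g0|k ck f /J0P f0].
- apply/J0P => h /cherednik_linear Lh.
  have := Lh (-1) 0 0; rewrite scaler0 addr0 scaleN1r addNr => ->.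
  exact: mcoeff0.
- apply/J0P => h ch; rewrite -(scale1r f) (cherednik_linear ch) scale1r.
  by rewrite mcoeffD f0 // g0 // addr0.
apply/J0P => h ch; exact: (f0 (h \o k) (cherednik_comp ch ck)).
Qed.

Lemma J0_max M : submodule W c M -> 1 \notin M -> {subset M <= J0}.
Proof.
move=> sM M1 f fM; apply/J0P => h ch; apply/eqP; apply: contraNT M1.
by apply: submodule_coef0 => //; have [_ _] := sM; apply.
Qed.

Lemma J0_proper : 1 \notin J0.
Proof.
apply/J0P => /(_ id (cherednik_id _ _)) /eqP.
by rewrite mcoeff1 eqxx oner_eq0.
Qed.

Lemma irreducible_quotient_J0 : irreducible_quotient W c J0.
Proof.
split; [exact: J0_submodule | by exists 1; exact: J0_proper |].
move=> M sM JM; have [M1|M1] := boolP (1 \in M).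
  by right; exact: (submodule_predT sM M1).
by left=> f; apply/idP/idP; [apply: J0_max|apply: JM].
Qed.

Lemma unique_irreducible_quotient :
  exists! J : {pred P}, irreducible_quotient W c J.
Proof.
exists J0; split=> [|J [sJ [g gJ] maxJ]]; first exact: irreducible_quotient_J0.
have J1 : 1 \notin J by apply: contra gJ => /(submodule_predT sJ) ->.
apply/funext => f; have [E|/(_ 1)] := maxJ J0 J0_submodule (J0_max sJ J1).
  exact: E.
by rewrite (negPf J0_proper).
Qed.

End Irreducible.

Definition irr_kernel (W : mxgroup F N) (c : F) : {pred P} :=
  projT1 (cid (unique_irreducible_quotient W c)).

Lemma irr_kernelP W c : irreducible_quotient W c (irr_kernel W c).
Proof. by rewrite /irr_kernel; case: cid => J []. Qed.

Lemma irr_kernel_zmod_closed W c : zmod_closed (irr_kernel W c).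
Proof.
have [sJ _ _] := irr_kernelP W c; have [J0 JD _] := sJ; split=> // f g fJ gJ.
by rewrite -scaleN1r; apply: JD => //; apply: (submoduleZ _ sJ).
Qed.

HB.instance Definition _ W c := GRing.isZmodClosed.Build P (irr_kernel W c)
  (irr_kernel_zmod_closed W c).

Definition Ltriv (W : mxgroup F N) (c : F) : Type :=
  Quotient.quot (irr_kernel W c).

HB.instance Definition _ W c := GRing.Zmodule.on (Ltriv W c).

Section Lmodule.
Variables (W : mxgroup F N) (c : F).
Local Notation L := (Ltriv W c).
Local Notation pi := (\pi_(Quotient.quot (irr_kernel W c))%qT : P -> L).

Definition Lscale (a : F) (v : L) : L := pi (a *: repr v).

Lemma pi_scale a f : pi (a *: f) = Lscale a (pi f).
Proof.
apply/eqP; rewrite -[_ == _]/(_ == _ %[mod Quotient.quot (irr_kernel W c)])%qT.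
rewrite -Quotient.idealrBE -scalerBr.
have [sJ _ _] := irr_kernelP W c; apply: (submoduleZ _ sJ).
by rewrite Quotient.idealrBE reprK.
Qed.

Let piD f g : pi (f + g) = pi f + pi g.
Proof. exact: (raddfD \pi_(Quotient.quot (irr_kernel W c))%qT). Qed.

Let piP (v : L) : exists f, v = pi f.
Proof. by exists (repr v); rewrite [RHS]reprK. Qed.

Lemma LscaleA a b v : Lscale a (Lscale b v) = Lscale (a * b) v.
Proof. by have [f ->] := piP v; rewrite -!pi_scale scalerA. Qed.

Lemma Lscale1 : left_id 1 Lscale.
Proof. by move=> v; have [f ->] := piP v; rewrite -pi_scale scale1r. Qed.

Lemma LscaleDr : right_distributive Lscale +%R.
Proof.
move=> a u v; have [f ->] := piP u; have [g ->] := piP v.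
by rewrite -piD -!pi_scale -piD scalerDr.
Qed.

Lemma LscaleDl v : {morph Lscale^~ v : a b / a + b}.
Proof.
by move=> a b; have [f ->] := piP v; rewrite -!pi_scale -piD scalerDl.
Qed.

HB.instance Definition _ := GRing.Zmodule_isLmodule.Build F L
  LscaleA Lscale1 LscaleDr LscaleDl.

End Lmodule.

End Cherednik.

Section SignedPermutations.

Variables (F : numFieldType) (N : nat).
Local Notation sperm := ({ffun 'I_N -> bool} * 'S_N)%type.

Definition sperm_mx (p : sperm) : 'M[F]_N :=
  \matrix_(i, j) (if p.2 i == j then (-1) ^+ p.1 i else 0).

Definition sperm_mul (p q : sperm) : sperm :=
  ([ffun i => p.1 i (+) q.1 (p.2 i)], (p.2 * q.2)%g).

Definition sperm_inv (p : sperm) : sperm :=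
  ([ffun i => p.1 (p.2^-1 i)%g], p.2^-1%g).

Lemma sperm_mxM p q : sperm_mx p *m sperm_mx q = sperm_mx (sperm_mul p q).
Proof.
apply/matrixP => i k; rewrite !mxE (bigD1 (p.2 i)) //= !mxE eqxx permM ffunE.
rewrite big1 ?addr0 => [|j ji]; last by rewrite !mxE eq_sym (negPf ji) mul0r.
by case: ifP => _; rewrite ?mulr0 // signr_addb.
Qed.

Lemma sperm_mx1 : sperm_mx ([ffun=> false], 1%g) = 1%:M.
Proof. by apply/matrixP => i j; rewrite !mxE perm1 ffunE expr0; case: eqP. Qed.

Lemma sperm_mulVp p : sperm_mul (sperm_inv p) p = ([ffun=> false], 1%g).
Proof.
by rewrite /sperm_mul mulVg; congr (_, _); apply/ffunP => i; rewrite !ffunE addbb.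
Qed.

Lemma sperm_mulpV p : sperm_mul p (sperm_inv p) = ([ffun=> false], 1%g).
Proof.
rewrite /sperm_mul mulgV; congr (_, _); apply/ffunP => i.
by rewrite !ffunE permK addbb.
Qed.

Lemma sperm_mx_unit p : sperm_mx p \in unitmx.
Proof.
have /mulmx1_unit[] // : sperm_mx p *m sperm_mx (sperm_inv p) = 1%:M.
by rewrite sperm_mxM sperm_mulpV sperm_mx1.
Qed.

Lemma sperm_mxV p : invmx (sperm_mx p) = sperm_mx (sperm_inv p).
Proof.
apply: (can_inj (mulKmx (sperm_mx_unit p))).
by rewrite mulmxV ?sperm_mx_unit // sperm_mxM sperm_mulpV sperm_mx1.
Qed.

Definition minus_ones (w : 'M[F]_N) : nat :=
  #|[set ij : 'I_N * 'I_N | w ij.1 ij.2 == -1]|.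

Lemma minus_ones_sperm p : minus_ones (sperm_mx p) = #|[set i | p.1 i]|.
Proof.
rewrite /minus_ones -(@card_imset _ _ (fun i => (i, p.2 i)) [set i | p.1 i]).
  apply: eq_card => -[i j]; rewrite !inE !mxE /=; apply/idP/imsetP.
    case: (eqVneq (p.2 i) j) => [<-|_]; last by rewrite eq_sym oppr_eq0 oner_eq0.
    case pi: (p.1 i) => [] h; first by exists i; rewrite ?inE.
    move: h; rewrite expr0 -subr_eq0 opprK -[1 + 1]/(2%:R).
    by rewrite pnatr_eq0.
  by case=> k; rewrite inE => pk [-> ->]; rewrite eqxx pk expr1.
by move=> i j [].
Qed.

Let oddE (A : pred 'I_N) :
  odd #|[set i | A i]| = \big[addb/false]_i A i.
Proof.
rewrite -sum1_card (big_morph odd oddD (erefl (odd 0))).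
rewrite [LHS]big_mkcond; apply: eq_bigr => i _.
by rewrite inE; case: (A i).
Qed.

Lemma odd_minus_onesM p q :
  odd (minus_ones (sperm_mx p *m sperm_mx q)) =
  odd (minus_ones (sperm_mx p)) (+) odd (minus_ones (sperm_mx q)).
Proof.
rewrite sperm_mxM !minus_ones_sperm !oddE /=.
rewrite [X in _ (+) X](reindex_inj (@perm_inj _ p.2)) /= -big_split.
by apply: eq_bigr => i _; rewrite ffunE.
Qed.

Definition G21_set : {fset 'M[F]_N} := [fset sperm_mx p | p in {: sperm}]%fset.

Definition G22_set : {fset 'M[F]_N} :=
  [fset w in G21_set | ~~ odd (minus_ones w)]%fset.

Lemma G21P w : reflect (exists p, w = sperm_mx p) (w \in G21_set).
Proof.
apply: (iffP idP) => [/imfsetP[p _ ->]|[p ->]]; first by exists p.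
by apply/imfsetP; exists p.
Qed.

Lemma G22P w :
  reflect (exists2 p, w = sperm_mx p & ~~ odd (minus_ones (sperm_mx p)))
          (w \in G22_set).
Proof.
rewrite !inE; apply: (iffP andP) => [[/G21P[p ->]]|[p -> ?]]; first by exists p.
by split=> //; apply/G21P; exists p.
Qed.

Lemma G21_1 : 1%:M \in G21_set.
Proof. by apply/G21P; exists ([ffun=> false], 1%g); rewrite sperm_mx1. Qed.

Lemma G21_M : {in G21_set &, forall u v, u *m v \in G21_set}.
Proof.
move=> _ _ /G21P[p ->] /G21P[q ->]; apply/G21P.
by exists (sperm_mul p q); rewrite sperm_mxM.
Qed.

Lemma G21_unit : {in G21_set, forall u, u \in unitmx}.
Proof. by move=> _ /G21P[p ->]; apply: sperm_mx_unit. Qed.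

Lemma G21_V : {in G21_set, forall u, invmx u \in G21_set}.
Proof.
by move=> _ /G21P[p ->]; apply/G21P; exists (sperm_inv p); rewrite sperm_mxV.
Qed.

Lemma minus_ones1 : minus_ones 1%:M = 0%N.
Proof.
rewrite -sperm_mx1 minus_ones_sperm; apply/eqP; rewrite cards_eq0.
by apply/eqP/setP => i; rewrite !inE ffunE.
Qed.

Lemma G22_1 : 1%:M \in G22_set.
Proof. by rewrite !inE G21_1 minus_ones1. Qed.

Lemma G22_M : {in G22_set &, forall u v, u *m v \in G22_set}.
Proof.
move=> _ _ /G22P[p -> ep] /G22P[q -> eq]; apply/G22P.
exists (sperm_mul p q); rewrite -sperm_mxM //.
by rewrite odd_minus_onesM (negPf ep) (negPf eq).
Qed.

Lemma G22_unit : {in G22_set, forall u, u \in unitmx}.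
Proof. by move=> _ /G22P[p -> _]; apply: sperm_mx_unit. Qed.

Lemma G22_V : {in G22_set, forall u, invmx u \in G22_set}.
Proof.
move=> _ /G22P[p -> ep]; apply/G22P; exists (sperm_inv p); rewrite ?sperm_mxV //.
move: (odd_minus_onesM p (sperm_inv p)).
by rewrite sperm_mxM sperm_mulpV sperm_mx1 minus_ones1 (negPf ep) /= => <-.
Qed.

Definition G21 : mxgroup F N := MxGroup G21_1 G21_M G21_unit G21_V.
Definition G22 : mxgroup F N := MxGroup G22_1 G22_M G22_unit G22_V.

End SignedPermutations.

(* The Weyl groups W(C_2n) and W(D_2n) acting on F^2n. *)
Definition WC (F : numFieldType) (n : nat) : mxgroup F (2 * n) := G21 F (2 * n).
Definition WD (F : numFieldType) (n : nat) : mxgroup F (2 * n) := G22 F (2 * n).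

(* L_{1/2n}(C_2n) and L_{1/2n}(D_2n) *)
Definition L_C (F : numFieldType) (n : nat) : lmodType F :=
  Ltriv (WC F n) (1 / (2 * n)%:R).
Definition L_D (F : numFieldType) (n : nat) : lmodType F :=
  Ltriv (WD F n) (1 / (2 * n)%:R).

Definition has_dim (F : fieldType) (V : lmodType F) (d : nat) : Prop :=
  exists b : 'I_d -> V,
    forall v, exists! a : 'rV[F]_d, v = \sum_i a 0 i *: b i.

Definition finite_dim (F : fieldType) (V : lmodType F) : Prop :=
  exists d, has_dim V d.

Lemma has_dim_leq (F : fieldType) (V : lmodType F) d e :
  has_dim V d -> has_dim V e -> (d <= e)%N.
Proof.
move=> [b hb] [b' hb'].
have [A eA] : exists A : 'M[F]_(d, e), forall i, b i = \sum_j A i j *: b' j.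
  exists (\matrix_i projT1 (cid (hb' (b i)))) => i.
  case: (cid (hb' (b i))) (mxE matrix_key (fun k => projT1 (cid (hb' (b k))) 0) i)
    => [a [ea _]] /= E; rewrite ea; apply: eq_bigr => j _.
  by rewrite E.
have [B eB] : exists B : 'M[F]_(e, d), forall i, b' i = \sum_j B i j *: b j.
  exists (\matrix_i projT1 (cid (hb (b' i)))) => i.
  case: (cid (hb (b' i))) (mxE matrix_key (fun k => projT1 (cid (hb (b' k))) 0) i)
    => [a [ea _]] /= E; rewrite ea; apply: eq_bigr => j _.
  by rewrite E.
suff /mulmx1_min : A *m B = 1%:M by [].
apply/row_matrixP => i; have [a [_ ua]] := hb (b i).
transitivity a; [apply/esym|]; apply: ua.
  rewrite eA; under eq_bigr do rewrite eB scaler_sumr.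
  rewrite exchange_big; apply: eq_bigr => k _ /=.
  by rewrite !mxE scaler_suml; apply: eq_bigr => j _; rewrite scalerA.
rewrite (bigD1 i) //= !mxE eqxx scale1r big1 ?addr0 // => j ji.
by rewrite !mxE eq_sym (negPf ji) scale0r.
Qed.

Lemma has_dim_inj (F : fieldType) (V : lmodType F) d e :
  has_dim V d -> has_dim V e -> d = e.
Proof.
by move=> hd he; apply/eqP; rewrite eqn_leq !(has_dim_leq hd he, has_dim_leq he hd).
Qed.

Definition vdim (F : fieldType) (V : lmodType F) : nat :=
  if pselect (finite_dim V) is left e then projT1 (cid e) else 0%N.

(* f : fps stands for the formal power series \sum_k f k * x^k. *)
Definition fps := nat -> rat.

Definition fps1 : fps := fun k => (k == 0%N)%:R.
Definition fps_add (f g : fps) : fps := fun k => f k + g k.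
Definition fps_mul (f g : fps) : fps :=
  fun k => \sum_(i < k.+1) f i * g (k - i)%N.
Definition fps_scale (a : rat) (f : fps) : fps := fun k => a * f k.

Definition gbinom (a : rat) (k : nat) : rat :=
  (\prod_(i < k) (a - i%:R)) / k`!%:R.

(* (1 - 4x)^a, by the binomial series *)
Definition one_sub_4x_pow (a : rat) : fps := fun k => gbinom a k * (- 4) ^+ k.

Definition sqrt_one_sub_4x : fps := one_sub_4x_pow (1 / 2).

(* Main.v *)
Require Import Defs.
From HB Require Import structures.
From mathcomp Require Import all_boot all_order all_algebra perm finmap.
From mathcomp Require Import complex mpoly generic_quotient ring_quotient.
From mathcomp Require Import boolp reals.
From mathcomp Require Import ring lra zify.

(** Put N = 2n and c = 1/N. The quadrics x_i^2 - x_j^2 vanish together exactly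
on the lines spanned by the sign vectors e in {1, -1}^N, and at c = 1/N they span
a space of singular vectors. So Dunkl operators act on the restrictions of
polynomials to these lines. At a point te, one of the two reflections
x_i <-> x_j and x_i <-> - x_j fixes the line and contributes a derivative; the
other one moves e to e with its i-th and j-th signs flipped, and contributes a
difference quotient. Because c N = 1, the partial derivatives combine into the
radial derivative d/dt ([restr_dunkl]).

The flips are diagonalized by the characters e |-> e_T, the product of the e_i
for i in T. The moment of f at (d, T) pairs the coefficient of t^d in f(te) with
this character. If U is T with the membership of i toggled, then the moment of
x_i f at (d + 1, T) is that of f at (d, U), and the moment of the i-th Dunkl
operator applied to f at (d - 1, T) is that of f at (d, U) times a scalar
([moment_dunkl]). For i in U this scalar is c (d + |U| - 2m), with m = n in type D
and m = n + 1 in type C; otherwise it is c (d - |U|). Consider the polynomials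
whose moments vanish at all (d, T) with d + |T| even and smaller than 2m. To leave
this range, a Dunkl operator would have to involve a moment with d + |U| = 2m and
i in U, where the scalar is 0; so they form a submodule. Below 2m the scalars that
serve to descend to the constant term are nonzero, so this is the maximal proper
submodule ([moment_kernelE]).

Hence L_c(Triv) has as a basis the classes of the monomials s^a x_T with
a + |T| < m, where s is the common class of the squares x_i^2 and x_T is
squarefree, and its dimension is the sum of C(2n, k) (m - k) over k < m
([has_dim_Ltriv]). A telescoping sum and the symmetry of the binomial
coefficients turn this into (2n - 1) C(2n - 2, n - 1) in type D and into
((n + 1) C(2n, n) + 4^n) / 2 in type C. On the other side, with r the square root
of 1 - 4x, the second series is (r^-3 + 2 r^-2 + r^-1) / 4, and the coefficients
of these powers come from the binomial series. *)

Import Order.TTheory GRing.Theory Num.Theory.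

Local Open Scope ring_scope.
Set Implicit Arguments.
Unset Strict Implicit.

(** * Reflections in groups of signed permutations *)

Section Reflections.
Variables (F : numFieldType) (N : nat).
Local Notation P := {mpoly F[N]}.
Local Notation sperm := ({ffun 'I_N -> bool} * 'S_N)%type.
Local Notation smx := (@sperm_mx F N).
Local Notation row0 i := (delta_mx 0 i : 'rV[F]_N).
Implicit Types (f g : P) (i j k : 'I_N) (b : bool) (p : sperm).

Let subUU i : (U_(i) - U_(i) = 0 :> 'X_{1.. N})%MM.
Proof. by apply/mnmP => k; rewrite mnmBE subnn mnm0E. Qed.

Lemma mderiv_lform (a : 'rV[F]_N) i : (lform a)^`M(i) = (a 0 i)%:MP.
Proof.
rewrite /lform raddf_sum (bigD1 i) //= big1 ?addr0 => [|j ji].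
  rewrite mderivZ mderivX mnmE eqxx scale1r subUU mpolyX0.
  by rewrite -mul_mpolyC mulr1.
by rewrite mderivZ mderivX mnmE (negPf ji) scale0r scaler0.
Qed.

Lemma mderiv_gact i (w : 'M[F]_N) f :
  (gact w f)^`M(i) = \sum_k invmx w k i *: gact w f^`M(k).
Proof.
elim/mpoly_alg_ind: f => [|j|p q ep eq|p q ep eq|a p ep].
- rewrite gact1 -mpolyC1 mderivC big1 // => k _.
  by rewrite mderivC raddf0 scaler0.
- rewrite gactX mderiv_lform mxE (bigD1 j) //= big1 => [|k kj].
    rewrite mderivX mnmE eqxx scale1r subUU mpolyX0 gact1 addr0.
    by rewrite -mul_mpolyC mulr1.
  by rewrite mderivX mnmE eq_sym (negPf kj) scale0r raddf0 scaler0.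
- rewrite gactM mderivM ep eq mulr_suml mulr_sumr -big_split.
  apply: eq_bigr => k _ /=.
  by rewrite mderivM raddfD /= !gactM scalerDr scalerAl scalerAr.
- rewrite raddfD /= mderivD ep eq -big_split; apply: eq_bigr => k _ /=.
  by rewrite mderivD raddfD /= scalerDr.
- rewrite linearZ /= mderivZ ep scaler_sumr; apply: eq_bigr => k _.
  by rewrite mderivZ [gact w (a *: _)]linearZ /= !scalerA mulrC.
Qed.

Lemma sperm_mx_inj : injective smx.
Proof.
have val p i k : smx p i k = if p.2 i == k then (-1) ^+ p.1 i else 0.
  by rewrite mxE.
move=> [a s] [b t] /matrixP e.
have st i : s i = t i.
  have := e i (s i); rewrite !val /= eqxx eq_sym; case: eqP => // _ /eqP.
  by rewrite signr_eq0.
congr (_, _); last exact/permP.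
apply/ffunP => i; have := e i (s i); rewrite !val /= st eqxx.
by move/signr_inj.
Qed.

(** The boolean is the sign: the form is x_i - x_j for false and x_i + x_j for
true, normalized to have coefficient 1 at x_i; it defines the hyperplane fixed by
[swap i j b]. *)
Definition swap_form i j b : 'rV[F]_N := row0 i - (-1) ^+ b *: row0 j.

Definition swap i j b : sperm :=
  ([ffun k => b && ((k == i) || (k == j))], tperm i j).

Definition negate i : sperm := ([ffun k => k == i], 1%g).

Lemma swap_mx i j b : i != j ->
  smx (swap i j b) - 1%:M = - ((swap_form i j b)^T *m swap_form i j b).
Proof.
move=> ij; apply/matrixP => k l; rewrite !mxE big_ord1 !mxE !ffunE /=.
case: tpermP => [->|->|/eqP ki /eqP kj].
- rewrite eqxx (negPf ij) (eq_sym l j) (eq_sym l i) andbT /=.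
  by case: b; case: (j == l); case: (i == l); rewrite /= ?expr1 ?expr0; ring.
- rewrite eqxx orbT (eq_sym j i) (negPf ij) (eq_sym l j) (eq_sym l i) andbT /=.
  by case: b; case: (j == l); case: (i == l); rewrite /= ?expr1 ?expr0; ring.
by rewrite (negPf ki) (negPf kj) /= andbF; case: (k == l) => /=; ring.
Qed.

Lemma negate_mx i : smx (negate i) - 1%:M = - 2 *: ((row0 i)^T *m row0 i).
Proof.
apply/matrixP => k l; rewrite !mxE big_ord1 !mxE !ffunE /= perm1.
rewrite (eq_sym l i); case: (eqVneq k i) => [->|ki] /=.
  by case: (i == l); rewrite /= ?expr1; ring.
by case: (k == l); rewrite /= ?expr0; ring.
Qed.

Lemma swap_sub i j b :
  i != j -> (smx (swap i j b) - 1%:M <= swap_form i j b)%MS.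
Proof. by move=> ij; rewrite swap_mx // -mulNmx submxMl. Qed.

Lemma negate_sub i : (smx (negate i) - 1%:M <= row0 i)%MS.
Proof. by rewrite negate_mx scalemxAl submxMl. Qed.

Lemma rank1_sub (M : 'M[F]_N) (v : 'rV[F]_N) i :
  (M <= v)%MS -> M i i != 0 -> \rank M == 1%N.
Proof.
move=> /mxrankS le_Mv Mii; rewrite eqn_leq (leq_trans le_Mv (rank_leq_row v)).
by rewrite lt0n mxrank_eq0; apply: contraNneq Mii => ->; rewrite mxE.
Qed.

Lemma swap_reflection i j b : i != j -> is_reflection (smx (swap i j b)).
Proof.
move=> ij; apply: (rank1_sub (swap_sub b ij) (i := i)).
by rewrite !mxE tpermL eqxx (eq_sym j) (negPf ij) sub0r oppr_eq0 oner_eq0.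
Qed.

Lemma negate_reflection i : is_reflection (smx (negate i)).
Proof.
apply: (rank1_sub (negate_sub i) (i := i)).
rewrite negate_mx !mxE big_ord1 !mxE !eqxx mulr1 mulf_eq0 oner_eq0 orbF.
by rewrite oppr_eq0 pnatr_eq0.
Qed.

(** A matrix of rank one has vanishing 2 x 2 minors. *)
Lemma reflection_minors (s : 'M[F]_N) (M := s - 1%:M) k l k' l' :
  is_reflection s -> M k l * M k' l' = M k l' * M k' l.
Proof.
move=> rs; have row_alpha m : exists a, row m M = a *: alpha s.
  by apply: alpha_span => //; apply: row_sub.
have [a ea] := row_alpha k; have [b eb] := row_alpha k'.
have entry m n : M m n = row m M 0 n by rewrite [RHS]mxE.
by rewrite (entry k) (entry k') (entry k l') (entry k' l) ea eb !mxE; ring.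
Qed.

(** Only the reflections that move the i-th coordinate enter the i-th Dunkl
operator. If s is one and M = s - 1, then M i i is nonzero, and the minors of M on
rows and columns i, k kill M k k for all other k except the image of i, so that
s fixes the k-th basis vector; the minor on i and its image makes both signs of a
transposition equal. *)
Lemma reflection_classification p i :
  is_reflection (smx p) -> alpha (smx p) 0 i != 0 ->
  p = negate i \/ exists2 j, i != j & exists b, p = swap i j b.
Proof.
move=> rs ai; pose M := smx p - 1%:M.
have minors k l k' l' : M k l * M k' l' = M k l' * M k' l.
  exact: reflection_minors.
have ME k l : M k l = (if p.2 k == l then (-1) ^+ p.1 k else 0) - (k == l)%:R.
  by rewrite !mxE.
have fixed k : M k k = 0 -> p.2 k = k /\ p.1 k = false.
  rewrite ME eqxx; case: eqP => [-> /eqP|_ /eqP].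
    rewrite subr_eq0; case: (p.1 k) => //; rewrite expr1 -subr_eq0 -opprD.
    by rewrite oppr_eq0 -[1 + 1]/(2%:R) pnatr_eq0.
  by rewrite sub0r oppr_eq0 oner_eq0.
have [k Mki] : exists k, M k i != 0.
  have /submxP[u eu] := nz_row_sub M; apply/existsP; apply: contra_neqT ai.
  rewrite negb_exists => /forallP Mi; rewrite /alpha -/M eu mxE big1 // => k _.
  by have := Mi k; rewrite negbK => /eqP ->; rewrite mulr0.
have fixed_off k' : M i i != 0 -> M k' i = 0 \/ M i k' = 0 ->
    p.2 k' = k' /\ p.1 k' = false.
  move=> Mii z; apply: fixed; apply: (mulIf Mii); rewrite minors mul0r.
  by case: z => ->; rewrite ?mulr0 ?mul0r.
case: (eqVneq (p.2 i) i) => [pi|pi]; [left|right].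
  have Mi k' : k' != i -> M k' i = 0.
    by move=> ki; rewrite ME -{1}pi (inj_eq perm_inj) (negPf ki) subr0.
  have ki : k = i by apply: contraNeq Mki => /Mi ->.
  have Mii : M i i != 0 by rewrite -{1}ki.
  have off k' : k' != i -> p.2 k' = k' /\ p.1 k' = false.
    by move=> /Mi z; apply: fixed_off => //; left.
  case: p pi @M minors ME fixed fixed_off Mi Mki Mii off rs ai => a s pi M.
  move=> _ ME _ _ _ _ Mii off _ _; rewrite /= in pi ME off; congr (_, _).
    apply/ffunP => k'; rewrite ffunE; case: eqVneq => [->|/off[]] //.
    by move: Mii; rewrite ME pi eqxx; case: (a i); rewrite // expr0 subrr eqxx.
  by apply/permP => k'; rewrite perm1; case: (eqVneq k' i) => [->|/off[]].
have Mii : M i i = -1 by rewrite ME (negPf pi) eqxx sub0r.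
have Mii0 : M i i != 0 by rewrite Mii oppr_eq0 oner_eq0.
exists (p.2 i); first by rewrite eq_sym.
exists (p.1 i).
have off k' : k' != i -> k' != p.2 i -> p.2 k' = k' /\ p.1 k' = false.
  move=> ki kj; apply: fixed_off => //; right.
  by rewrite ME eq_sym (negPf kj) eq_sym (negPf ki) subr0.
have pj : p.2 (p.2 i) = i.
  apply: contraNeq pi => pji; apply/eqP.
  case: (eqVneq (p.2 (p.2 i)) (p.2 i)) => [|pjj]; first exact: perm_inj.
  by have [/perm_inj/perm_inj] := off _ pji pjj.
have sj : p.1 (p.2 i) = p.1 i.
  have := minors (p.2 i) (p.2 i) i i; rewrite Mii !ME pj !eqxx.
  rewrite (negPf pi) eq_sym (negPf pi) !subr0 sub0r mulrNN mulr1.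
  move=> /esym; case: (p.1 _); case: (p.1 i) => //;
    rewrite ?expr1 ?expr0 ?mul1r ?mulr1 => /eqP; rewrite -subr_eq0 -opprD;
    by rewrite oppr_eq0 -[1 + 1]/(2%:R) pnatr_eq0.
case: p @M {minors ME fixed fixed_off Mki Mii Mii0 rs ai} pi off pj sj => a s M /=.
move=> pi off pj sj; congr (_, _).
  apply/ffunP => k'; rewrite ffunE; case: (eqVneq k' i) => [->|ki].
    by rewrite andbT.
  case: (eqVneq k' (s i)) => [->|kj]; first by rewrite sj andbT.
  by rewrite andbF; have [] := off _ ki kj.
apply/permP => k'; case: tpermP => [->|->|/eqP ki /eqP kj] //.
by have [] := off _ ki kj.
Qed.

End Reflections.

(** * Dunkl operators as sums of divided differences *)

Section DunklFormula.
Variables (F : numFieldType) (N : nat).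
Local Notation P := {mpoly F[N]}.
Local Notation sperm := ({ffun 'I_N -> bool} * 'S_N)%type.
Local Notation smx := (@sperm_mx F N).
Local Notation row0 i := (delta_mx 0 i : 'rV[F]_N).
Implicit Types (f g : P) (i j k : 'I_N) (b : bool) (p : sperm).

(** The factor [alpha s 0 i] makes this independent of the scaling of the form
chosen for s, so any normalized form may replace [alpha s]: see [divdiffE]. *)
Definition divdiff (s : 'M[F]_N) i f : P :=
  alpha s 0 i *: mdivide (f - gact s f) (lform (alpha s)).

Lemma divdiffE s i f (v : 'rV[F]_N) : is_reflection s ->
  (s - 1%:M <= v)%MS -> v 0 i = 1 -> divdiff s i f * lform v = f - gact s f.
Proof.
move=> rs sv vi; have /sub_rVP[a ea] := submx_trans (nz_row_sub _) sv.
rewrite -(mdivideK (divided_difference_exists f rs)) /divdiff [alpha s]ea.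
by rewrite linearZ /= !mxE vi mulr1 -scalerAr -scalerAl.
Qed.

Lemma alpha_coord_neq0 s i (v : 'rV[F]_N) : is_reflection s ->
  (s - 1%:M <= v)%MS -> v 0 i = 1 -> alpha s 0 i != 0.
Proof.
move=> rs sv vi; have /sub_rVP[a ea] := submx_trans (nz_row_sub _) sv.
have := alpha_neq0 rs; rewrite [alpha s]ea mxE vi mulr1.
by apply: contraNneq => ->; rewrite scale0r.
Qed.

Lemma swap_form_coord i j b : i != j -> swap_form F i j b 0 i = 1.
Proof. by move=> ij; rewrite !mxE !eqxx (negPf ij) mulr0 subr0. Qed.

Lemma delta_coord i : row0 i 0 i = 1.
Proof. by rewrite mxE !eqxx. Qed.

Lemma dunkl_coord (W : mxgroup F N) c (y : 'cV[F]_N) f :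
  dunkl W c y f = \sum_i y i 0 *: dunkl W c (delta_mx i 0) f.
Proof.
under eq_bigr do rewrite scalerBr dderiv_delta.
rewrite sumrB /dunkl; congr (_ - _); under [RHS]eq_bigr do rewrite scaler_sumr.
rewrite exchange_big; apply: eq_bigr => s _ /=.
rewrite mxE mulr_sumr scaler_suml; apply: eq_bigr => i _.
by rewrite -colE mxE !scalerA; congr (_ *: _); ring.
Qed.

Lemma dunkl_delta (W : mxgroup F N) c i f :
  dunkl W c (delta_mx i 0) f =
  f^`M(i) - c *: \sum_(s <- W | is_reflection s) divdiff s i f.
Proof.
rewrite /dunkl dderiv_delta scaler_sumr; congr (_ - _); apply: eq_bigr => s _.
by rewrite -colE mxE -scalerA.
Qed.

(** W(C) and W(D) differ by the sign changes; the boolean [B] tells whether they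
are present. *)
Lemma big_reflections (W : mxgroup F N) (T : 'M[F]_N -> P) i B :
  {subset mxg_set W <= G21_set F N} ->
  (forall j b, i != j -> smx (swap i j b) \in mxg_set W) ->
  (smx (negate i) \in mxg_set W) = B ->
  (forall s, alpha s 0 i = 0 -> T s = 0) ->
  \sum_(s <- W | is_reflection s) T s =
  \sum_(j | i != j) (T (smx (swap i j false)) + T (smx (swap i j true)))
    + (if B then T (smx (negate i)) else 0).
Proof.
move=> WG Wswap Wneg T0.
pose sw (x : 'I_N * bool) := smx (swap i x.1 x.2).
pose S := [seq sw x | x <- enum [pred x : 'I_N * bool | i != x.1]].
rewrite (bigID (fun s => alpha s 0 i == 0)) /= big1 ?add0r; last first.
  by move=> s /andP[_ /eqP]; apply: T0.
rewrite -big_filter; set L := filter _ _.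
transitivity (\sum_(s <- S ++ (if B then [:: smx (negate i)] else [::])) T s).
  apply: perm_big; apply: uniq_perm; first by rewrite filter_uniq ?fset_uniq.
    rewrite cat_uniq map_inj_in_uniq ?enum_uniq //=; last first.
      move=> [j b] [j' b']; rewrite !mem_enum !inE /= => ij ij'.
      move=> /sperm_mx_inj[/ffunP/(_ i) e1 /permP/(_ i) e2].
      by move: e1 e2; rewrite !ffunE eqxx !andbT !tpermL => -> ->.
    case: (B) => //=; rewrite orbF andbT; apply/mapP => -[[j b]].
    rewrite mem_enum inE /= => ij /sperm_mx_inj[_ /permP/(_ i)].
    by rewrite perm1 tpermL => e; rewrite e eqxx in ij.
  move=> s; rewrite mem_filter mem_cat; apply/andP/orP.
    case=> /andP[rs ai] sW; have /G21P[p e] := WG _ sW; subst s.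
    have [e|[j ij [b e]]] := reflection_classification rs ai.
      by right; rewrite -Wneg -e sW inE.
    by left; apply/mapP; exists (j, b); rewrite ?mem_enum ?inE // /sw e.
  case=> [/mapP[[j b]]|].
    rewrite mem_enum inE /= => ij ->.
    split; last exact: Wswap.
    have sub := swap_sub F b ij; have rs := swap_reflection F b ij.
    by rewrite rs (alpha_coord_neq0 rs sub) // swap_form_coord.
  case: (B) Wneg => // Wneg; rewrite inE => /eqP ->; split; last by rewrite Wneg.
  have rs := negate_reflection F i; rewrite rs.
  by rewrite (alpha_coord_neq0 rs (negate_sub F i)) // delta_coord.
rewrite big_cat /=; congr (_ + _); last by case: (B); rewrite ?big_seq1 ?big_nil.
rewrite big_map big_enum_cond /=.
under eq_bigl do rewrite inE.
transitivity (\sum_(j | i != j) \sum_(b : bool) T (smx (swap i j b))).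
  by rewrite pair_big_dep /=; apply: eq_bigl => -[j b]; rewrite andbT.
by apply: eq_bigr => j _; rewrite big_bool addrC.
Qed.

End DunklFormula.

(** * Restriction to the lines spanned by sign vectors *)

Section Restriction.
Variables (F : numFieldType) (N : nat).
Local Notation P := {mpoly F[N]}.
Local Notation sperm := ({ffun 'I_N -> bool} * 'S_N)%type.
Local Notation signs := {ffun 'I_N -> bool}.
Local Notation smx := (@sperm_mx F N).
Local Notation row0 i := (delta_mx 0 i : 'rV[F]_N).
Implicit Types (f g : P) (i j k : 'I_N) (b : bool) (p : sperm) (e : signs).

(** f on the line spanned by the sign vector e: the polynomial f(te) in t. *)
Definition restr e f : {poly F} :=
  mmap polyC (fun i => (-1) ^+ e i *: 'X) f.

HB.instance Definition _ e := GRing.RMorphism.copy (restr e)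
  (mmap polyC (fun i => (-1) ^+ e i *: 'X)).

Lemma restrZ e a f : restr e (a *: f) = a *: restr e f.
Proof. by rewrite -mul_mpolyC rmorphM /= /restr mmapC mul_polyC. Qed.

Lemma restrX e i : restr e 'X_i = (-1) ^+ e i *: 'X.
Proof. by rewrite /restr mmapX mmap1U. Qed.

Lemma restr_lform e (a : 'rV[F]_N) :
  restr e (lform a) = (\sum_i a 0 i * (-1) ^+ e i) *: 'X.
Proof.
rewrite /lform raddf_sum scaler_suml; apply: eq_bigr => i _ /=.
by rewrite restrZ restrX scalerA.
Qed.

Lemma restr_deriv e f : (restr e f)^`() = \sum_i (-1) ^+ e i *: restr e f^`M(i).
Proof.
elim/mpoly_alg_ind: f => [|j|p q ep eq|p q ep eq|a p ep].
- rewrite rmorph1 derivC big1 // => i _.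
  by rewrite -mpolyC1 mderivC raddf0 scaler0.
- have -> : 'X_j = lform (row0 j).
    rewrite /lform (bigD1 j) //= mxE !eqxx scale1r big1 ?addr0 // => k kj.
    by rewrite mxE (negPf kj) scale0r.
  rewrite restr_lform derivZ derivX (bigD1 j) //= [RHS](bigD1 j) //=.
  rewrite !big1 ?addr0; first last.
  - by move=> k kj; rewrite mxE (negPf kj) mul0r.
  - by move=> k kj; rewrite mderiv_lform mxE (negPf kj) andbF mpolyC0 raddf0 scaler0.
  rewrite mderiv_lform mxE !eqxx /= rmorph1 rmorph1.
  by rewrite mul1r.
- rewrite rmorphM /= derivM ep eq mulr_suml mulr_sumr -big_split.
  apply: eq_bigr => i _ /=; rewrite mderivM raddfD /= !rmorphM /= scalerDr.
  by rewrite -scalerAl -scalerAr.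
- rewrite !raddfD /= ep eq -big_split; apply: eq_bigr => i _ /=.
  by rewrite mderivD raddfD /= scalerDr.
- rewrite restrZ derivZ ep scaler_sumr; apply: eq_bigr => i _.
  by rewrite mderivZ restrZ !scalerA mulrC.
Qed.

(** The image of the sign vector e under the inverse of [sperm_mx p]. *)
Definition act_signs p e : signs :=
  [ffun k => p.1 (p.2^-1 k)%g (+) e (p.2^-1 k)%g].

Lemma restr_gact e p f : restr e (gact (smx p) f) = restr (act_signs p e) f.
Proof.
elim/mpoly_alg_ind: f => [|i|p1 q1 ep eq|p1 q1 ep eq|a p1 ep].
- by rewrite gact1 !rmorph1.
- rewrite gactX restr_lform restrX; congr (_ *: _).
  rewrite sperm_mxV (bigD1 (p.2^-1 i)%g) //= !mxE /= eqxx !ffunE /=.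
  rewrite big1 ?addr0 ?signr_addb // => k kp.
  by rewrite !mxE /= eq_sym (negPf kp) mul0r.
- by rewrite gactM !rmorphM /= ep eq.
- by rewrite !raddfD /= ep eq.
- by rewrite linearZ /= !restrZ ep.
Qed.

Definition flip i e : signs := [ffun k => e k (+) (k == i)].

Lemma flipK i : involutive (flip i).
Proof. by move=> e; apply/ffunP => k; rewrite !ffunE -addbA addbb addbF. Qed.

Lemma act_signs_negate e i : act_signs (negate i) e = flip i e.
Proof. by apply/ffunP => k; rewrite !ffunE invg1 perm1 addbC. Qed.

Lemma act_signs_swap_eq e i j : act_signs (swap i j (e i (+) e j)) e = e.
Proof.
apply/ffunP => k; rewrite !ffunE /= tpermV; case: tpermP => [->|->|/eqP ki /eqP kj].
- by rewrite eqxx orbT andbT addbK.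
- by rewrite eqxx andbT addbC addKb.
by rewrite (negPf ki) (negPf kj) andbF.
Qed.

Lemma act_signs_swap_neq e i j : i != j ->
  act_signs (swap i j (~~ (e i (+) e j))) e = flip i (flip j e).
Proof.
move=> ij; apply/ffunP => k; rewrite !ffunE /= tpermV.
case: tpermP => [->|->|/eqP ki /eqP kj].
- rewrite !eqxx (negPf ij) orbT.
  by case: (e i); case: (e j).
- by rewrite !eqxx (eq_sym j i) (negPf ij); case: (e i); case: (e j).
by rewrite (negPf ki) (negPf kj) andbF !addbF.
Qed.

Lemma restr_swap_form e i j b :
  restr e (lform (swap_form F i j b)) =
  if b == e i (+) e j then 0 else (2 * (-1) ^+ e i) *: 'X.
Proof.
have restr0 k : restr e (lform (row0 k)) = (-1) ^+ e k *: 'X.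
  rewrite restr_lform (bigD1 k) //= mxE !eqxx mul1r big1 ?addr0 // => l lk.
  by rewrite mxE (negPf lk) mul0r.
rewrite /swap_form raddfB /= [lform (_ *: _)]linearZ /= raddfB /= restrZ !restr0.
rewrite scalerA -scalerBl.
by case: b; case: (e i); case: (e j); rewrite /= ?expr0 ?expr1 -1?[RHS](scale0r 'X);
   congr (_ *: _); ring.
Qed.

(** Let b be the sign for which [swap i j b] fixes e. Then the form of
[swap i j b] vanishes on the line, and differentiating the equation of its divided
difference in x_i gives the value of the latter on the line; the other
reflection flips both signs and its form takes the value 2 e_i t. *)
Lemma restr_swap_pair e i j f (q : bool -> P) : i != j ->
  (forall b, q b * lform (swap_form F i j b) = f - gact (smx (swap i j b)) f) ->
  'X * (restr e (q false) + restr e (q true)) =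
  'X * (restr e f^`M(i) - (-1) ^+ e i *: ((-1) ^+ e j *: restr e f^`M(j)))
   + ((-1) ^+ e i / 2) *: (restr e f - restr (flip i (flip j e)) f).
Proof.
move=> ij qE; set b := e i (+) e j.
have -> : restr e (q false) + restr e (q true) = restr e (q b) + restr e (q (~~ b)).
  by case: b; rewrite //= addrC.
rewrite mulrDr; congr (_ + _).
  congr (_ * _); have := congr1 (mderiv i) (qE b).
  rewrite mderivM mderivB mderiv_gact mderiv_lform swap_form_coord // mulr1.
  move=> /(congr1 (restr e)); rewrite raddfD /= rmorphM /= restr_swap_form eqxx mulr0.
  rewrite add0r => ->; rewrite raddfB /=; congr (_ - _).
  rewrite sperm_mxV (bigD1 j) //= big1 ?addr0 => [|k kj].
    rewrite mxE /= tpermV tpermR eqxx !ffunE /= tpermR eqxx andbT.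
    by rewrite restrZ restr_gact act_signs_swap_eq scalerA -signr_addb.
  rewrite mxE /= tpermV -(inj_eq (@perm_inj _ (tperm i j))) tpermK tpermL.
  by rewrite (negPf kj) scale0r.
have := congr1 (restr e) (qE (~~ b)); rewrite rmorphM /= restr_swap_form.
have -> : (~~ b == e i (+) e j) = false by rewrite -/b; case: (b).
rewrite raddfB /= restr_gact act_signs_swap_neq // => <-.
rewrite -scalerAr scalerA mulrC -[LHS]scale1r; congr (_ *: _).
by rewrite mulrA divfK ?pnatr_eq0 // -expr2 sqrr_sign.
Qed.

Lemma restr_negate e i f (q : P) :
  q * lform (row0 i) = f - gact (smx (negate i)) f ->
  'X * restr e q = (-1) ^+ e i *: (restr e f - restr (flip i e) f).
Proof.
move=> /(congr1 (restr e)); rewrite rmorphM /= raddfB /= restr_gact act_signs_negate => <-.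
rewrite restr_lform (bigD1 i) //= mxE !eqxx mul1r big1 ?addr0.
  by rewrite -scalerAr scalerA -expr2 sqrr_sign scale1r mulrC.
by move=> l li; rewrite mxE (negPf li) mul0r.
Qed.

End Restriction.

(** W(C_N) or W(D_N), so that both types are treated at once. *)
Definition WCD (F : numFieldType) (N : nat) (C : bool) : mxgroup F N :=
  if C then G21 F N else G22 F N.

Section DunklRestriction.
Variables (F : numFieldType) (N : nat) (C : bool).
Local Notation P := {mpoly F[N]}.
Local Notation sperm := ({ffun 'I_N -> bool} * 'S_N)%type.
Local Notation signs := {ffun 'I_N -> bool}.
Local Notation smx := (@sperm_mx F N).
Local Notation W := (WCD F N C).
Local Notation D i := (dunkl W N%:R^-1 (delta_mx i 0)).
Implicit Types (f g : P) (i j k : 'I_N) (b : bool) (p : sperm) (e : signs).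
Implicit Types (d : nat) (T U : {set 'I_N}).

Lemma WCD_sub : {subset mxg_set W <= G21_set F N}.
Proof. by rewrite /WCD; case: C => // s; rewrite !inE => /andP[]. Qed.

Lemma swap_in_WCD i j b : i != j -> smx (swap i j b) \in mxg_set W.
Proof.
move=> ij; have in21 : smx (swap i j b) \in G21_set F N.
  by apply/G21P; exists (swap i j b).
rewrite /WCD; case: C => //=; rewrite !inE in21 minus_ones_sperm /=.
case: b {in21}; last first.
  by rewrite (_ : [set _ | _] = set0) ?cards0 //; apply/setP => k; rewrite !inE ffunE.
rewrite (_ : [set _ | _] = [set i; j]) ?cards2 ?ij //.
by apply/setP => k; rewrite !inE ffunE.
Qed.

Lemma negate_in_WCD i : (smx (negate i) \in mxg_set W) = C.
Proof.
have in21 : smx (negate i) \in G21_set F N by apply/G21P; exists (negate i).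
rewrite /WCD; case: C => //=; rewrite !inE in21 minus_ones_sperm /=.
rewrite (_ : [set _ | _] = [set i]) ?cards1 //.
by apply/setP => k; rewrite !inE ffunE.
Qed.

(** The N - 1 pairs of reflections leave the partial derivative in x_i with
coefficient 1 - c (N - 1) = c, which fits those in the other variables into the
derivative along the line. *)
Lemma restr_dunkl e i f :
  'X * restr e (D i f) =
  (N%:R^-1 * (-1) ^+ e i) *: ('X * (restr e f)^`()
    - \sum_(j | i != j) 2^-1 *: (restr e f - restr (flip i (flip j e)) f)
    - (if C then restr e f - restr (flip i e) f else 0)).
Proof.
have N0 : N%:R != 0 :> F by rewrite pnatr_eq0; case: (N) i => [[]|].
set c := N%:R^-1; set s := (-1) ^+ e i; set r := restr e f.
rewrite dunkl_delta (big_reflections WCD_sub (fun j b => @swap_in_WCD i j b)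
  (negate_in_WCD i)); last by move=> t a0; rewrite /divdiff a0 scale0r.
have pair j : i != j ->
    'X * (restr e (divdiff (smx (swap i j false)) i f)
          + restr e (divdiff (smx (swap i j true)) i f)) =
    'X * (restr e f^`M(i) - s *: ((-1) ^+ e j *: restr e f^`M(j)))
     + (s / 2) *: (r - restr (flip i (flip j e)) f).
  move=> ij; apply: (restr_swap_pair e
    (q := fun b => divdiff (smx (swap i j b)) i f) ij) => b.
  apply: divdiffE (swap_form_coord F b ij).
    exact: swap_reflection.
  exact: swap_sub.
have neg : 'X * restr e (divdiff (smx (negate i)) i f) = s *: (r - restr (flip i e) f).
  apply: restr_negate; apply: divdiffE (delta_coord F i).
    exact: negate_reflection.
  exact: negate_sub.
have -> : 'X * restr e (f^`M(i) - c *: (\sum_(j | i != j)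
      (divdiff (smx (swap i j false)) i f + divdiff (smx (swap i j true)) i f)
      + (if C then divdiff (smx (negate i)) i f else 0))) =
    'X * restr e f^`M(i) - c *: (\sum_(j | i != j)
      ('X * (restr e f^`M(i) - s *: ((-1) ^+ e j *: restr e f^`M(j)))
       + (s / 2) *: (r - restr (flip i (flip j e)) f))
      + (if C then s *: (r - restr (flip i e) f) else 0)).
  rewrite raddfB /= restrZ mulrBr -scalerAr; congr (_ - _ *: _).
  rewrite raddfD /= mulrDr raddf_sum mulr_sumr; congr (_ + _).
    by apply: eq_bigr => j ij; rewrite raddfD /= pair.
  by case: (C); rewrite ?neg // raddf0 mulr0.
have card_i : #|[pred j | i != j]| = N.-1.
  by rewrite (eq_card (B := predC1 i)) ?cardC1 ?card_ord // => j; rewrite !inE eq_sym.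
have deriv : r^`() = s *: restr e f^`M(i)
    + \sum_(j | i != j) (-1) ^+ e j *: restr e f^`M(j).
  by rewrite restr_deriv (bigD1 i) //=; congr (_ + _); apply: eq_bigl => j; rewrite eq_sym.
rewrite deriv big_split /= -mulr_sumr sumrB sumr_const card_i -!scaler_sumr.
set S1 := \sum_(j | i != j) _ *: _; set S2 := \sum_(j | i != j) _.
set y := restr e _.
have -> : (if C then s *: (r - restr (flip i e) f) else 0) =
   s *: (if C then r - restr (flip i e) f else 0).
  by case: (C); rewrite // scaler0.
set t := (if C then _ else _).
have N1 : y = c *: y + c *: (y *+ N.-1).
  rewrite -scalerDr -mulrS prednK; last by rewrite lt0n -(pnatr_eq0 F).
  by rewrite -scaler_nat scalerA mulVf // scale1r.
have s2 : s%:P * s%:P = 1 :> {poly F} by rewrite -polyCM -expr2 sqrr_sign.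
rewrite {1}N1 -!mul_polyC !polyCM; ring: s2.
Qed.

End DunklRestriction.

(** * Moments over the sign vectors *)

(** A subspace stable under the variables is an ideal. *)
Lemma mpoly_mul_stable (F : numFieldType) (N : nat) (Q : {mpoly F[N]} -> Prop) :
  (forall f g, Q f -> Q g -> Q (f + g)) -> (forall a f, Q f -> Q (a *: f)) ->
  (forall i f, Q f -> Q ('X_i * f)) -> forall p f, Q f -> Q (p * f).
Proof.
move=> QD QZ QX p; elim/mpoly_alg_ind: p => [|i|p q ep eq|p q ep eq|a p ep] f Qf.
- by rewrite mul1r.
- exact: QX.
- by rewrite -mulrA; apply/ep/eq.
- by rewrite mulrDl; apply: QD; [apply: ep|apply: eq].
- by rewrite -scalerAl; apply/QZ/ep.
Qed.

Section Toggle.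
Variable A : finType.
Implicit Types (i : A) (T : {set A}).

(** The symmetric difference of T and the singleton of i. *)
Definition toggle i T := if i \in T then T :\ i else i |: T.

Lemma toggleK i : involutive (toggle i).
Proof.
move=> T; rewrite /toggle; case: (boolP (i \in T)) => iT.
  by rewrite setD11 setD1K.
by rewrite setU11 setU1K.
Qed.

Lemma in_toggle i T : (i \in toggle i T) = (i \notin T).
Proof. by rewrite /toggle; case: (boolP (i \in T)) => iT; rewrite ?setD11 ?setU11. Qed.

Lemma card_toggle i T :
  if i \in T then #|T| = #|toggle i T|.+1 else #|toggle i T| = #|T|.+1.
Proof.
rewrite /toggle; case: (boolP (i \in T)) => iT; first by rewrite (cardsD1 i T) iT.
by rewrite (cardsU1 i T) iT.
Qed.

End Toggle.

Section Moments.
Variables (F : numFieldType) (N : nat).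
Local Notation P := {mpoly F[N]}.
Local Notation sperm := ({ffun 'I_N -> bool} * 'S_N)%type.
Local Notation signs := {ffun 'I_N -> bool}.
Local Notation smx := (@sperm_mx F N).
Implicit Types (f g : P) (i j k : 'I_N) (b : bool) (p : sperm) (e : signs).
Implicit Types (d : nat) (T U : {set 'I_N}).

Definition sign_char e T : F := \prod_(k in T) (-1) ^+ e k.

(** Up to the factor 2^N, the sum of the coefficients in f of the monomials of
degree d whose set of variables with odd exponent is T. *)
Definition moment d T f : F := \sum_e sign_char e T * (restr e f)`_d.

Lemma sign_char_toggle e i T :
  sign_char e (toggle i T) = (-1) ^+ e i * sign_char e T.
Proof.
rewrite /sign_char /toggle; case: ifP => iT; last by rewrite big_setU1 //= iT.
by rewrite (big_setD1 i iT) /= mulrA -expr2 sqrr_sign mul1r.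
Qed.

Lemma sign_char_flip e i T :
  sign_char (flip i e) T = (-1) ^+ (i \in T) * sign_char e T.
Proof.
rewrite /sign_char; case: (boolP (i \in T)) => iT.
  rewrite !(big_setD1 i iT) /= ffunE eqxx addbT signrN mulrA mulN1r.
  congr (_ * _); apply: eq_bigr => k; rewrite !inE => /andP[ki _].
  by rewrite ffunE (negPf ki) addbF.
rewrite mul1r; apply: eq_bigr => k kT; rewrite ffunE.
by rewrite (_ : k == i = false) ?addbF //; apply: contraNF iT => /eqP <-.
Qed.

Lemma sign_char_orthogonal T U :
  \sum_e sign_char e T * sign_char e U = if T == U then (2 ^ N)%:R else 0.
Proof.
case: (eqVneq T U) => [->|TU].
  rewrite (eq_bigr (fun=> 1)) => [|e _].
    by rewrite sumr_const card_ffun card_bool card_ord.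
  by rewrite -big_split big1 // => k _; rewrite /= -expr2 sqrr_sign.
have [i iTU] : exists i, (i \in T) (+) (i \in U).
  apply/existsP; apply: contraNT TU => /existsPn TU; apply/eqP/setP => i.
  by apply/eqP; rewrite -negb_add; apply: TU.
have : \sum_e sign_char e T * sign_char e U = - \sum_e sign_char e T * sign_char e U.
  rewrite {1}(reindex_inj (inv_inj (flipK i))) -sumrN.
  apply: eq_bigr => e _; rewrite !sign_char_flip mulrACA -signr_addb iTU.
  by rewrite expr1 mulN1r.
by move/eqP; rewrite -addr_eq0 -mulr2n mulrn_eq0 => /eqP.
Qed.

Lemma moment_is_linear d T : linear_for *%R (moment d T).
Proof.
move=> a f g; rewrite /moment mulr_sumr -big_split; apply: eq_bigr => e _ /=.
by rewrite raddfD /= restrZ coefD coefZ mulrDr mulrCA.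
Qed.
HB.instance Definition _ d T := GRing.isLinear.Build F P F _ (moment d T)
  (moment_is_linear d T).

Lemma moment1 d T :
  moment d T 1 = if (d == 0%N) && (T == set0) then (2 ^ N)%:R else 0.
Proof.
rewrite /moment; case: d => [|d] /=.
  rewrite -sign_char_orthogonal; apply: eq_bigr => e _.
  by rewrite rmorph1 coefC {3}/sign_char big_set0.
by rewrite big1 // => e _; rewrite rmorph1 coefC mulr0.
Qed.

Lemma momentX0 i T f : moment 0 T ('X_i * f) = 0.
Proof.
rewrite /moment big1 // => e _.
by rewrite rmorphM /= restrX -scalerAl coefZ coefXM mulr0 mulr0.
Qed.

Lemma momentXS d i T f : moment d.+1 T ('X_i * f) = moment d (toggle i T) f.
Proof.
apply: eq_bigr => e _; rewrite rmorphM /= restrX -scalerAl coefZ coefXM /=.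
by rewrite sign_char_toggle mulrCA mulrA.
Qed.

Lemma moment_flip d T f i :
  \sum_e sign_char e T * (restr (flip i e) f)`_d = (-1) ^+ (i \in T) * moment d T f.
Proof.
rewrite (reindex_inj (inv_inj (flipK i))) mulr_sumr; apply: eq_bigr => e _.
by rewrite flipK sign_char_flip mulrA.
Qed.

Lemma moment_flip2 d T f i j :
  \sum_e sign_char e T * (restr (flip i (flip j e)) f)`_d =
  (-1) ^+ ((i \in T) (+) (j \in T)) * moment d T f.
Proof.
rewrite signr_addb [X in X * _]mulrC -mulrA -moment_flip mulr_sumr.
rewrite (reindex_inj (inv_inj (flipK j))); apply: eq_bigr => e _.
by rewrite flipK sign_char_flip; ring.
Qed.

Lemma sign_char_act_signs p T : exists s : F,
  forall e, sign_char e T = s * sign_char (act_signs p e) (p.2 @: T).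
Proof.
exists (\prod_(k in T) (-1) ^+ p.1 k) => e; rewrite /sign_char big_imset /=; last by move=> k l _ _; apply: perm_inj.
rewrite -big_split; apply: eq_bigr => k _; rewrite /= ffunE permK signr_addb.
by rewrite mulrA -expr2 sqrr_sign mul1r.
Qed.

Lemma moment_gact d T f p : exists s : F,
  moment d T (gact (smx p) f) = s * moment d (p.2 @: T) f.
Proof.
have [s es] := sign_char_act_signs p T; exists s.
have act_signs_inj : injective (act_signs p).
  move=> e1 e2 /ffunP E; apply/ffunP => k; have := E (p.2 k).
  by rewrite !ffunE permK => /addbI.
rewrite /moment mulr_sumr [RHS](reindex_inj act_signs_inj) /=.
by apply: eq_bigr => e _; rewrite restr_gact es mulrA.
Qed.

Lemma moment0 T f : moment 0 T f = f@_0%MM * \sum_e sign_char e T.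
Proof.
rewrite /moment mulr_sumr; apply: eq_bigr => e _; rewrite mulrC; congr (_ * _).
elim/mpoly_alg_ind: f => [|i|p q ep eq|p q ep eq|a p ep].
- by rewrite rmorph1 coefC mcoeff1 eqxx.
- by rewrite restrX coefZ coefX mulr0 mcoeffX mnm1_eq0.
- by rewrite rmorphM /= coef0M ep eq (rmorphM (mcoeff 0%MM)).
- by rewrite !raddfD /= coefD ep eq.
- by rewrite restrZ coefZ ep mcoeffZ.
Qed.

(** A monomial of degree d has at most d variables with odd exponent. *)
Lemma moment_lt d T f : (d < #|T|)%N -> moment d T f = 0.
Proof.
move=> dT; rewrite -(mulr1 f).
suff : forall d T, (d < #|T|)%N -> moment d T (f * 1) = 0 by apply.
apply: (mpoly_mul_stable (Q := fun g =>
  forall d T, (d < #|T|)%N -> moment d T g = 0)) => {f d T dT}.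
- by move=> f g Qf Qg d T dT; rewrite raddfD /= Qf // Qg // addr0.
- by move=> a f Qf d T dT; rewrite linearZ /= Qf // mulr0.
- move=> i f Qf [|d] T dT; first by rewrite momentX0.
  rewrite momentXS Qf //; move: dT (card_toggle i T).
  by move: #|T| #|toggle i T| => t u dT; case: ifP => _ e; lia.
move=> d T dT; rewrite moment1; case: ifP => // /andP[_ /eqP T0].
by rewrite T0 cards0 in dT.
Qed.

(** A representative of s^a x_T, the square of the i0-th variable standing for s. *)
Definition monomial (i0 : 'I_N) (a : nat) T : P :=
  'X_i0 ^+ a.*2 * \prod_(i in T) 'X_i.

Lemma moment_monomial i0 (a : nat) T d U : moment d U (monomial i0 a T) =
  if (d == a.*2 + #|T|)%N && (U == T) then (2 ^ N)%:R else 0.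
Proof.
have restrE e : restr e (monomial i0 a T) = sign_char e T *: 'X^(a.*2 + #|T|).
  rewrite /monomial rmorphM rmorphXn rmorph_prod /= restrX exprZn -mul2n exprM.
  rewrite sqrr_sign expr1n scale1r; under eq_bigr do rewrite restrX.
  by rewrite scaler_prod prodr_const -scalerAr exprD mul2n.
rewrite /moment; under eq_bigr do rewrite restrE coefZ coefXn mulrA.
rewrite -mulr_suml sign_char_orthogonal.
by case: (d == _); case: (U == T); rewrite ?mulr1 ?mulr0 ?mul0r.
Qed.


Variable C : bool.
Local Notation W := (WCD F N C).
Local Notation D i := (dunkl W N%:R^-1 (delta_mx i 0)).

(** The eigenvalue on t^d e_U of the operator in parentheses in [restr_dunkl]. *)
Definition weight d U i : F :=
  if i \in U then (d + #|U|)%:R - (N + 2 * C)%:R else d%:R - #|U|%:R.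

(** On the character e_U, half of 1 minus the flip of i and j is 1 if U separates
i and j and 0 otherwise, so the sum over j counts the elements on the other side
of U than i. *)
Lemma moment_dunkl d T i f (U := toggle i T) :
  moment d T (D i f) = N%:R^-1 * weight d.+1 U i * moment d.+1 U f.
Proof.
set c := N%:R^-1; set K := moment d.+1 U f.
have -> : moment d T (D i f) = c * (d.+1%:R * K
    - \sum_(j | i != j) 2^-1 * (K - (-1) ^+ ((i \in U) (+) (j \in U)) * K)
    - (if C then K - (-1) ^+ (i \in U) * K else 0)).
  transitivity (\sum_e c * (sign_char e U * ((restr e f)`_d.+1 *+ d.+1
      - \sum_(j | i != j) 2^-1 *
          ((restr e f)`_d.+1 - (restr (flip i (flip j e)) f)`_d.+1)
      - (if C then (restr e f)`_d.+1 - (restr (flip i e) f)`_d.+1 else 0)))).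
    apply: eq_bigr => e _; have := congr1 (coefp d.+1) (restr_dunkl C e i f).
    rewrite /= coefXM /= => ->; rewrite coefZ !coefB coefXM /= coef_deriv.
    rewrite (coef_sum _ (fun j => i != j)) -/c sign_char_toggle -!mulrA mulrCA; congr (_ * _).
    rewrite [RHS]mulrCA; congr (_ * (_ * (_ - _ - _))).
      by apply: eq_bigr => j _; rewrite coefZ coefB.
    by case: (C); rewrite ?coefB ?coef0.
  rewrite -mulr_sumr; congr (_ * _).
  under eq_bigr do rewrite !mulrBr.
  rewrite !sumrB; congr (_ - _ - _).
  - by rewrite /K /moment mulr_sumr; apply: eq_bigr => e _; rewrite mulrnAr mulr_natl.
  - under eq_bigr do rewrite mulr_sumr.
    rewrite exchange_big; apply: eq_bigr => j _ /=.
    rewrite -moment_flip2 /K /moment -sumrB mulr_sumr; apply: eq_bigr => e _.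
    by rewrite mulrCA mulrBr.
  case: (C); last by rewrite big1 // => e _; rewrite mulr0.
  rewrite -moment_flip /K /moment -sumrB; apply: eq_bigr => e _.
  by rewrite mulrBr.
rewrite -mulrA; congr (_ * _).
have half b : 2^-1 * (K - (-1) ^+ b * K) = b%:R * K.
  by case: b; rewrite /= ?expr1 ?expr0; field.
under eq_bigr do rewrite half.
rewrite -mulr_suml -natr_sum.
have -> : (if C then K - (-1) ^+ (i \in U) * K else 0) =
    (2 * C * (i \in U))%:R * K.
  by case: (C); case: (i \in U); rewrite /= ?expr1 ?expr0; ring.
have -> : (\sum_(j | i != j) ((i \in U) (+) (j \in U)) =
    if i \in U then N - #|U| else #|U|)%N.
  have -> : (\sum_(j | i != j) ((i \in U) (+) (j \in U)) =
      \sum_j ((i \in U) (+) (j \in U)))%N.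
    by rewrite [RHS](bigD1 i) //= addbb add0n; apply: eq_bigl => j; rewrite eq_sym.
  case: ifP => iU; last first.
    by rewrite -sum1_card [RHS]big_mkcond; apply: eq_bigr => j _; case: (j \in U).
  have -> : (N - #|U| = #|~: U|)%N by rewrite (cardsCs (~: U)) setCK card_ord.
  rewrite -sum1_card.
  rewrite [RHS]big_mkcond; apply: eq_bigr => j _; rewrite in_setC.
  by case: (j \in U).
rewrite /weight; case: ifP => iU; last by rewrite muln0; ring.
rewrite muln1 -!mulrBl natrB; last by rewrite -[X in (_ <= X)%N]card_ord max_card.
by rewrite !natrD; ring.
Qed.

End Moments.

(** * The maximal submodule *)

Section Kernel.
Variables (F : numFieldType) (N : nat) (C : bool) (m : nat).
Hypotheses (N_gt0 : (0 < N)%N) (mE : (m.*2 = N + 2 * C)%N).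
Local Notation P := {mpoly F[N]}.
Local Notation W := (WCD F N C).
Local Notation c := (N%:R^-1 : F).
Local Notation D i := (dunkl W c (delta_mx i 0)).
Local Notation moment := (@moment F N).
Implicit Types (f g : P) (i j k : 'I_N) (d : nat) (T U : {set 'I_N}).

(** The moments with d + |T| odd are all zero. Leaving them out spares the case
d + |T| = 2m - 1, from which a Dunkl operator may reach 2m + 1 with weight 1. *)
Definition moment_kernel : {pred P} := fun f =>
  `[< forall d T, ~~ odd (d + #|T|) -> (d + #|T| < m.*2)%N -> moment d T f = 0 >].

Lemma moment_kernelP f :
  reflect (forall d T, ~~ odd (d + #|T|) -> (d + #|T| < m.*2)%N -> moment d T f = 0)
          (f \in moment_kernel).
Proof. exact: asboolP. Qed.

Let KD f g : f \in moment_kernel -> g \in moment_kernel -> f + g \in moment_kernel.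
Proof.
move=> /moment_kernelP Kf /moment_kernelP Kg; apply/moment_kernelP => d T o lt.
by rewrite raddfD /= Kf // Kg // addr0.
Qed.

Let KZ a f : f \in moment_kernel -> a *: f \in moment_kernel.
Proof.
move=> /moment_kernelP Kf; apply/moment_kernelP => d T o lt.
by rewrite linearZ /= Kf // mulr0.
Qed.

Lemma moment_kernelX i f : f \in moment_kernel -> 'X_i * f \in moment_kernel.
Proof.
move=> /moment_kernelP Kf; apply/moment_kernelP => -[|d] T o lt.
  by rewrite momentX0.
rewrite momentXS; have := card_toggle i T.
move: o lt (Kf d (toggle i T)); move: #|T| #|toggle i T| => t u o lt K.
case: ifP => _ e; apply: K; lia.
Qed.

Lemma moment_kernel_dunkl i f : f \in moment_kernel -> D i f \in moment_kernel.
Proof.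
move=> /moment_kernelP Kf; apply/moment_kernelP => d T o lt.
rewrite moment_dunkl /weight -mE in_toggle.
move: o lt (Kf d.+1 (toggle i T)) (card_toggle i T).
move: (moment _ _ _) #|T| #|toggle i T| => x t u o lt K.
case: (i \in T) => /= e; first by rewrite K ?mulr0 //; lia.
have [lt2|ge2] := ltnP (d.+1 + u) m.*2; first by rewrite K ?mulr0 //; lia.
(* As d + |T| is even, only d + 1 + |U| = 2m is left, where the weight is 0. *)
have -> : (d.+1 + u = m.*2)%N by lia.
by rewrite subrr mulr0 mul0r.
Qed.

Lemma moment_kernel_submodule : submodule W c moment_kernel.
Proof.
split=> [|f g|h].
- by apply/moment_kernelP => d T _ _; rewrite raddf0.
- exact: KD.
elim=> {h} [w wW|p|y||h k _ Kh _ Kk|h k _ Kh _ Kk|a h _ Kh] f Kf.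
- have /G21P[p ->] := WCD_sub wW; apply/moment_kernelP => d T o lt.
  have [s ->] := moment_gact d T f p; move/moment_kernelP: Kf => ->; rewrite ?mulr0 //;
  by rewrite card_imset //; apply: perm_inj.
- by apply: (mpoly_mul_stable (Q := fun g => g \in moment_kernel));
    [exact: KD|exact: KZ|exact: moment_kernelX|].
- rewrite dunkl_coord; apply: (big_ind (fun g => g \in moment_kernel)) => [|//|i _].
    by apply/moment_kernelP => d T _ _; rewrite raddf0.
  exact/KZ/moment_kernel_dunkl.
- by [].
- exact/Kh/Kk.
- by apply: KD; [apply: Kh|apply: Kk].
- exact/KZ/Kh.
Qed.

(** By induction on d: a Dunkl operator relates the moment at (d + 1, T) to one of
degree d, and its weight is nonzero if i is in T, because d + 1 + |T| < 2m, and
for every i if T is empty, where it is d + 1. *)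
Lemma J0_sub_moment_kernel : {subset J0 W c <= moment_kernel}.
Proof.
move=> f Jf; apply/moment_kernelP => d T _; elim: d T f Jf => [|d IH] T f Jf lt.
  rewrite moment0; have /J0P/(_ id (cherednik_id _ _)) -> := Jf.
  by rewrite mul0r.
have [_ _ stable] := J0_submodule W c.
have step i : weight F C d.+1 T i != 0 -> (d + #|toggle i T| < m.*2)%N ->
    moment d.+1 T f = 0.
  move=> w0 lt'; have := moment_dunkl C d (toggle i T) i f.
  rewrite toggleK IH //; last by apply: stable => //; apply: cherednik_dunkl.
  move/esym/eqP; rewrite !mulf_eq0 (negPf w0) orbF invr_eq0 pnatr_eq0.
  by rewrite eqn0Ngt N_gt0 => /eqP.
have [T0|/set0Pn[i iT]] := eqVneq T set0.
  apply: (step (Ordinal N_gt0)); last first.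
    move: lt (card_toggle (Ordinal N_gt0) T); rewrite T0 inE cards0 => lt ->.
    by rewrite addn1 -[d.+1]addn0.
  by rewrite /weight T0 !inE cards0 subr0 pnatr_eq0.
apply: (step i); last first.
  move: lt (card_toggle i T); rewrite iT => lt e.
  by rewrite e addSn addnS in lt; exact: (ltnW (ltnW lt)).
by rewrite /weight iT -mE subr_eq0 eqr_nat neq_ltn lt.
Qed.

(** The moments of a proper submodule vanish in the given range by descent to the
constant term, and conversely 1 has a nonzero moment at (0, {}), so the kernel of
the moments is proper. *)
Lemma moment_kernelE : irr_kernel W c =i moment_kernel.
Proof.
have [J [_ uJ]] := unique_irreducible_quotient W c.
rewrite -(uJ _ (irr_kernelP W c)) (uJ _ (irreducible_quotient_J0 W c)).
move=> f; apply/idP/idP; first exact: J0_sub_moment_kernel.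
apply: J0_max; first exact: moment_kernel_submodule.
apply/moment_kernelP => /(_ 0 set0); rewrite cards0 addn0 => /(_ isT).
have -> : (0 < m.*2)%N by lia.
move=> /(_ isT) /eqP; rewrite moment1 !eqxx /= pnatr_eq0.
by rewrite expn_eq0.
Qed.

End Kernel.


(** * Dimension of the irreducible quotient *)

Section Dimension.
Variables (F : numFieldType) (N : nat) (W : mxgroup F N) (c : F).
Local Notation P := {mpoly F[N]}.
Local Notation L := (Ltriv W c).
Local Notation pi := (\pi_(Quotient.quot (irr_kernel W c))%qT : P -> L).

Lemma pi_eq f g : (pi f == pi g) = (f - g \in irr_kernel W c).
Proof.
rewrite -[_ == _]/(_ == _ %[mod Quotient.quot (irr_kernel W c)])%qT.
by rewrite -Quotient.idealrBE.
Qed.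

(** The coordinates of the class of f are the values of the functionals at f. *)
Lemma has_dim_dual_basis (I : finType) (A : {set I}) (phi : I -> {scalar P})
    (b : I -> P) :
  {in A &, forall x y, phi x (b y) = (x == y)%:R} ->
  (forall f, reflect {in A, forall x, phi x f = 0} (f \in irr_kernel W c)) ->
  has_dim L #|A|.
Proof.
move=> dual kerP; exists (fun i => pi (b (enum_val i))) => v.
have piD (f g : P) : pi (f + g) = pi f + pi g.
  exact: (raddfD \pi_(Quotient.quot (irr_kernel W c))%qT).
have pi0 : pi 0 = 0 by apply: (raddf0 \pi_(Quotient.quot (irr_kernel W c))%qT).
have [f ->] : exists f, v = pi f by exists (repr v); rewrite [RHS]reprK.
have combE (a : 'rV[F]_#|A|) : \sum_i a 0 i *: pi (b (enum_val i)) =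
    pi (\sum_i a 0 i *: b (enum_val i)).
  rewrite (big_morph pi piD pi0); apply: eq_bigr => i _.
  by rewrite [RHS]pi_scale.
have coord (a : 'rV[F]_#|A|) j :
    phi (enum_val j) (\sum_i a 0 i *: b (enum_val i)) = a 0 j.
  rewrite raddf_sum (bigD1 j) //= linearZ /= dual ?enum_valP // eqxx mulr1.
  rewrite big1 ?addr0 // => i ij; rewrite linearZ /= dual ?enum_valP //.
  by rewrite (inj_eq enum_val_inj) eq_sym (negPf ij) mulr0.
exists (\row_i phi (enum_val i) f); split.
  rewrite combE; apply/eqP; rewrite pi_eq; apply/kerP => x xA.
  rewrite raddfB /= -(enum_rankK_in xA xA) coord mxE subrr //.
move=> a /eqP; rewrite combE pi_eq => /kerP ker; apply/rowP => j; rewrite mxE.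
have := ker _ (enum_valP j); rewrite raddfB /= coord => /eqP.
by rewrite subr_eq0 => /eqP.
Qed.

End Dimension.

Lemma card_monomial_index (N m : nat) :
  #|[set x : 'I_m * {set 'I_N} | (x.1 + #|x.2| < m)%N]| =
  (\sum_(k < m) 'C(N, k) * (m - k))%N.
Proof.
rewrite -sum1_card (eq_bigl (fun x : 'I_m * {set 'I_N} => (x.1 + #|x.2| < m)%N)); last first.
  by move=> x; rewrite inE.
rewrite -(pair_big_dep xpredT
  (fun (b : 'I_m) (T : {set 'I_N}) => (b + #|T| < m)%N) (fun _ _ => 1%N)) /=.
rewrite (exchange_big_dep xpredT) //=.
transitivity (\sum_(T : {set 'I_N}) \sum_(k < m | #|T| == k) (m - k))%N.
  apply: eq_bigr => T _; under eq_bigl do rewrite addnC -ltn_subRL.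
  rewrite (big_ord_narrow (leq_subr #|T| m)) sum1_card card_ord.
  case: (ltnP #|T| m) => lt.
    by rewrite (big_pred1 (Ordinal lt)) => // k; rewrite -val_eqE eq_sym.
  rewrite big1 => [|k /eqP e]; last by move: (ltn_ord k); rewrite -e ltnNge lt.
  by apply/eqP; rewrite subn_eq0.
rewrite (exchange_big_dep xpredT) //=; apply: eq_bigr => k _.
rewrite sum_nat_const; congr (_ * _)%N.
by rewrite -[N in RHS]card_ord -card_draws; apply: eq_card => T; rewrite !inE.
Qed.

(** The moments at (2a + |T|, T) with a + |T| < m cut out the maximal submodule,
those with d < |T| being zero anyway, and are dual to the monomials s^a x_T. *)
Lemma has_dim_Ltriv (F : numFieldType) (N : nat) (C : bool) (m : nat) :
  (0 < N)%N -> (m.*2 = N + 2 * C)%N ->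
  has_dim (Ltriv (WCD F N C) N%:R^-1) (\sum_(k < m) 'C(N, k) * (m - k)).
Proof.
move=> N_gt0 mE; rewrite -card_monomial_index.
pose phi (x : 'I_m * {set 'I_N}) : {scalar {mpoly F[N]}} :=
  moment (x.1.*2 + #|x.2|) x.2.
pose b (x : 'I_m * {set 'I_N}) :=
  (2 ^ N)%:R^-1 *: monomial F (Ordinal N_gt0) x.1 x.2.
apply: (has_dim_dual_basis (phi := phi) (b := b)) => [[b1 T] [b2 U] _ _|f].
  rewrite /phi /b linearZ /= moment_monomial -pair_eqE /= andbC.
  have [->|TU] := eqVneq T U; last by rewrite /= andbF mulr0.
  rewrite eqn_add2r -!muln2 eqn_pmul2r // andbT (val_eqE b1 b2).
  case: (b1 == b2); last by rewrite mulr0.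
  by rewrite mulVf // pnatr_eq0 expn_eq0.
rewrite (moment_kernelE N_gt0 mE).
apply: (iffP (moment_kernelP _ _)) => [K [b1 T]|K d T].
  rewrite inE /= => lt; apply: K; rewrite -addnA addnn -doubleD ?odd_double //.
  by rewrite ltn_double.
have [dT|Td] := ltnP d #|T|; first by rewrite moment_lt.
move=> o lt; have even : ((d - #|T|)./2.*2 = d - #|T|)%N.
  by rewrite even_halfK // oddB // -oddD.
have bm : ((d - #|T|)./2 + #|T| < m)%N.
  by rewrite -ltn_double doubleD even -addnn addnA subnK.
have := K (Ordinal (leq_ltn_trans (leq_addr _ _) bm), T).
by rewrite inE /phi /= even subnK // => ->.
Qed.

Lemma vdimE (F : fieldType) (V : lmodType F) d : has_dim V d -> vdim V = d.
Proof.
move=> dV; rewrite /vdim; case: pselect => [e|[]]; last by exists d.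
by case: (cid e) => d' /= /has_dim_inj; apply.
Qed.


(** * Binomial sums and binomial series *)

Lemma gbinomS a k : k.+1%:R * gbinom a k.+1 = (a - k%:R) * gbinom a k.
Proof.
rewrite /gbinom big_ord_recr /= factS natrM.
have h1 : k.+1%:R != 0 :> rat by rewrite pnatr_eq0.
have h2 : k`!%:R != 0 :> rat by rewrite pnatr_eq0 -lt0n fact_gt0.
by field; rewrite h2 addrC natr1 h1.
Qed.

Lemma gbinom0 a : gbinom a 0 = 1.
Proof. by rewrite /gbinom big_ord0 fact0 divr1. Qed.

(** Both sides satisfy the recurrence of [gbinomS]: in the sum for k + 1, write the
factor k + 1 as i + (k + 1 - i) and apply the recurrence to either factor. *)
Lemma gbinom_Vandermonde a b k :
  \sum_(i < k.+1) gbinom a i * gbinom b (k - i)%N = gbinom (a + b) k.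
Proof.
elim: k => [|k IH]; first by rewrite big_ord1 !gbinom0 mulr1.
have k0 : k.+1%:R != 0 :> rat by rewrite pnatr_eq0.
apply: (mulfI k0); rewrite gbinomS -IH mulr_sumr.
transitivity (\sum_(i < k.+2) (i%:R * gbinom a i) * gbinom b (k.+1 - i)%N +
    \sum_(i < k.+2) gbinom a i * ((k.+1 - i)%:R * gbinom b (k.+1 - i)%N)).
  rewrite -big_split; apply: eq_bigr => i _ /=.
  rewrite natrB -1?ltnS //; ring.
rewrite [X in X + _]big_ord_recl [X in _ + X]big_ord_recr /=.
rewrite subnn !mul0r mulr0 add0r addr0 -big_split mulr_sumr.
apply: eq_bigr => i _ /=; rewrite /bump /= add1n subSS gbinomS.
by rewrite subSn -1?ltnS // gbinomS natrB -1?ltnS //; ring.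
Qed.

Lemma one_sub_4x_powD a b :
  fps_mul (one_sub_4x_pow a) (one_sub_4x_pow b) =1 one_sub_4x_pow (a + b).
Proof.
move=> k; rewrite /fps_mul /one_sub_4x_pow -gbinom_Vandermonde mulr_suml.
apply: eq_bigr => i _.
have -> : (- 4) ^+ k = (- 4) ^+ i * (- 4) ^+ (k - i) :> rat.
  by rewrite -exprD subnKC // -ltnS.
ring.
Qed.

Lemma one_sub_4x_powS a k : k.+1%:R * one_sub_4x_pow a k.+1 =
  4 * (k%:R - a) * one_sub_4x_pow a k.
Proof. by rewrite /one_sub_4x_pow mulrA gbinomS exprS; ring. Qed.

Lemma one_sub_4x_pow0 a : one_sub_4x_pow a 0 = 1.
Proof. by rewrite /one_sub_4x_pow gbinom0 expr0 mulr1. Qed.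

Lemma central_binS n :
  (n.+1 * 'C(2 * n.+1, n.+1) = 2 * (2 * n).+1 * 'C(2 * n, n))%N.
Proof.
have e2 : (2 * n.+1 = (2 * n).+2)%N by lia.
have e3 : ('C((2 * n).+1, n.+1) = 'C((2 * n).+1, n))%N.
  by rewrite -bin_sub; [congr ('C(_, _)); lia|lia].
have := mul_bin_diag (2 * n).+1 n; have := mul_bin_left (2 * n) n.
have := binS (2 * n) n; have := binS (2 * n).+1 n.
rewrite e2 e3 => *; nia.
Qed.

Lemma one_sub_4x_powN1 k : one_sub_4x_pow (-1) k = 4 ^+ k.
Proof.
elim: k => [|k IH]; first by rewrite one_sub_4x_pow0.
apply: (mulfI (_ : k.+1%:R != 0)); first by rewrite pnatr_eq0.
by rewrite one_sub_4x_powS IH exprS -natr1; ring.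
Qed.

Lemma one_sub_4x_pow_half k : one_sub_4x_pow (- (1 / 2)) k = 'C(2 * k, k)%:R.
Proof.
elim: k => [|k IH]; first by rewrite one_sub_4x_pow0 bin0.
apply: (mulfI (_ : k.+1%:R != 0)); first by rewrite pnatr_eq0.
rewrite one_sub_4x_powS IH -natrM central_binS !natrM -(natr1 (2 * k)) natrM.
by field.
Qed.

Lemma one_sub_4x_pow_3half k :
  one_sub_4x_pow (- (3 / 2)) k = ((2 * k).+1 * 'C(2 * k, k))%:R.
Proof.
elim: k => [|k IH]; first by rewrite one_sub_4x_pow0 bin0.
apply: (mulfI (_ : k.+1%:R != 0)); first by rewrite pnatr_eq0.
rewrite one_sub_4x_powS IH -natrM mulnCA central_binS !natrM.
rewrite -(natr1 (2 * k)) -(natr1 (2 * k.+1)) !natrM -natr1.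
by field.
Qed.

(** Telescoping: 2 C(2n, k) (n - k) = (k + 1) C(2n, k + 1) - k C(2n, k). *)
Lemma sum_bin_lower n j :
  (\sum_(k < j) 'C(2 * n, k)%:R * (n%:R - k%:R)) *+ 2 = j%:R * 'C(2 * n, j)%:R
  :> rat.
Proof.
elim: j => [|j IH]; first by rewrite big_ord0 mul0r mul0rn.
rewrite big_ord_recr /= mulrnDl IH -[RHS]natrM mul_bin_left.
case: (leqP j (2 * n)) => h; last by rewrite bin_small // muln0 mulr0 mul0r mul0rn addr0.
by rewrite natrM natrB // natrM; ring.
Qed.

(** By the symmetry k |-> 2n - k, twice the lower half of the row counts the
middle coefficient once more than the whole row does. *)
Lemma sum_bin_half n :
  ((\sum_(k < n.+1) 'C(2 * n, k)) * 2 = 4 ^ n + 'C(2 * n, n))%N.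
Proof.
have -> : (4 ^ n = \sum_(0 <= k < (2 * n).+1) 'C(2 * n, k))%N.
  rewrite big_mkord -[4%N]/(2 ^ 2)%N -expnM -[2%N in LHS]/(1 + 1)%N expnDn.
  by apply: eq_bigr => i _; rewrite !exp1n !muln1.
rewrite -(big_mkord xpredT (fun k => 'C(2 * n, k))).
have le_n : (n <= (2 * n).+1)%N by lia.
rewrite (big_cat_nat (leq0n n) le_n) /= muln2 -addnn {1}big_nat_recr //=.
rewrite -!addnA; congr (_ + _)%N; rewrite addnC; congr (_ + _)%N.
rewrite big_nat_rev /=.
rewrite -[RHS]/(\sum_(0 + n <= i < (2 * n).+1) 'C(2 * n, i))%N big_addn.
have -> : ((2 * n).+1 - n = n.+1)%N by lia.
apply: eq_big_nat => i hi; rewrite -bin_sub; last by lia.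
by congr ('C(_, _)); lia.
Qed.

(** With r = (1 - 4x)^(1/2), expand r^-3 (1 + r)^2 = r^-3 + 2 r^-2 + r^-1. *)
Lemma fps_half_formula n :
  fps_mul (one_sub_4x_pow (- (3 / 2)))
    (fps_scale (1 / 4) (fps_mul (fps_add fps1 sqrt_one_sub_4x)
                                (fps_add fps1 sqrt_one_sub_4x))) n =
  (n.+1%:R * 'C(2 * n, n)%:R + 4 ^+ n) / 2.
Proof.
have mulfps1 (f : fps) k : fps_mul f fps1 k = f k.
  rewrite /fps_mul big_ord_recr /= subnn mulr1 big1 ?add0r // => i _.
  by rewrite /fps1 subn_eq0 leqNgt ltn_ord mulr0.
have fps1mul (f : fps) k : fps_mul fps1 f k = f k.
  rewrite /fps_mul big_ord_recl /= subn0 mul1r big1 ?addr0 // => i _.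
  by rewrite mul0r.
have mulfpsD (f g h : fps) k :
    fps_mul f (fps_add g h) k = fps_mul f g k + fps_mul f h k.
  by rewrite -big_split; apply: eq_bigr => i _; rewrite mulrDr.
have mulDfps (f g h : fps) k :
    fps_mul (fps_add g h) f k = fps_mul g f k + fps_mul h f k.
  by rewrite -big_split; apply: eq_bigr => i _; rewrite mulrDl.
have eq_fps (f g h : fps) k : g =1 h -> fps_mul f g k = fps_mul f h k.
  by move=> e; apply: eq_bigr => i _; rewrite e.
have mulfpsZ (f g : fps) a k : fps_mul f (fps_scale a g) k = a * fps_mul f g k.
  by rewrite mulr_sumr; apply: eq_bigr => i _; rewrite mulrCA.
rewrite mulfpsZ.
have /eq_fps-> : fps_mul (fps_add fps1 sqrt_one_sub_4x)
    (fps_add fps1 sqrt_one_sub_4x) =1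
    fps_add (fps_add fps1 sqrt_one_sub_4x)
      (fps_add sqrt_one_sub_4x (one_sub_4x_pow (1 / 2 + 1 / 2))).
  by move=> k; rewrite mulDfps !mulfpsD !fps1mul mulfps1 one_sub_4x_powD.
rewrite !mulfpsD mulfps1 !one_sub_4x_powD.
have -> : - (3 / 2) + 1 / 2 = -1 :> rat by [].
have -> : - (3 / 2) + (1 / 2 + 1 / 2) = - (1 / 2) :> rat by [].
rewrite one_sub_4x_powN1 one_sub_4x_pow_half one_sub_4x_pow_3half.
by rewrite natrM -(natr1 (2 * n)) natrM -natr1; field.
Qed.

Lemma sum_dim_D n : (\sum_(k < n.+1) 'C(2 * n.+1, k) * (n.+1 - k) =
  (2 * n).+1 * 'C(2 * n, n))%N.
Proof.
apply/eqP; rewrite -(eqr_nat rat) natr_sum.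
under eq_bigr => k _ do rewrite natrM natrB 1?ltnW //.
have := sum_bin_lower n.+1 n.+1; rewrite -[X in _ = X]natrM central_binS.
by rewrite -mulnA natrM mulr_natl => /(pmulrnI (isT : 0 < 2)%N) ->.
Qed.

Lemma sum_dim_C n : ((\sum_(k < n.+1) 'C(2 * n, k) * (n.+1 - k))%N)%:R =
  (n.+1%:R * 'C(2 * n, n)%:R + 4 ^+ n) / 2 :> rat.
Proof.
rewrite natr_sum.
under eq_bigr => k _.
  rewrite natrM natrB 1?ltnW // -natr1 -addrAC mulrDr mulr1.
  over.
rewrite big_split /=.
have := sum_bin_lower n n.+1; have := sum_bin_half n.
rewrite -natr_sum.
move=> /(congr1 (GRing.natmul (1 : rat))); rewrite natrM natrD natrX => h1 h2.
have h3 : (n.+1)%:R * 'C(2 * n, n.+1)%:R = n%:R * 'C(2 * n, n)%:R :> rat.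
  by rewrite -!natrM mul_bin_left; congr (_ * _)%:R; lia.
rewrite -natr1; lra.
Qed.

(** * Generating functions of the dimensions *)

Lemma has_dim_L_D (F : numFieldType) n :
  has_dim (L_D F n.+1) ((2 * n).+1 * 'C(2 * n, n)).
Proof.
rewrite -sum_dim_D /L_D div1r.
by apply: (@has_dim_Ltriv F (2 * n.+1) false n.+1); lia.
Qed.

Lemma has_dim_L_C (F : numFieldType) n : (0 < n)%N ->
  has_dim (L_C F n) (\sum_(k < n.+1) 'C(2 * n, k) * (n.+1 - k)).
Proof.
move=> n0; rewrite /L_C div1r.
by apply: (@has_dim_Ltriv F (2 * n) true n.+1); lia.
Qed.


Theorem mainTheorem4 (R : realType) :
  [/\ forall n : nat, (0 < n)%N ->
        finite_dim (L_D R[i] n) /\ finite_dim (L_C R[i] n),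
      (* the coefficient of x^k in the first sum is the term n = k + 1 *)
      (fun k => (vdim (L_D R[i] k.+1))%:R : rat) =1 one_sub_4x_pow (- (3 / 2))
    & fps_add fps1
        (fun n => if (0 < n)%N then (vdim (L_C R[i] n))%:R else 0) =1
      fps_mul (one_sub_4x_pow (- (3 / 2)))
        (fps_scale (1 / 4)
          (fps_mul (fps_add fps1 sqrt_one_sub_4x)
                   (fps_add fps1 sqrt_one_sub_4x)))].
Proof.
split=> [[|n] // n0|k|n].
- split; eexists; [exact: has_dim_L_D|exact: has_dim_L_C].
- by rewrite (vdimE (has_dim_L_D _ k)) one_sub_4x_pow_3half.
rewrite fps_half_formula /fps_add /fps1; case: n => [|n].
  by rewrite bin0.
by rewrite (vdimE (has_dim_L_C _ (ltn0Sn n))) sum_dim_C add0r.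
Qed.
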